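(* Let $h$ be a monotone hiding distribution on a rooted tree network $Q$. Then $h$ is strongly simply searchable, i.e. the only optimal searches against $h$ are depth-first searches.
   Context: $Q$ is a (finite) tree network with root node $O$: each arc $a$ is a segment of length $\lambda(a)>0$, and points of $Q$ may be nodes or interior points of arcs. $\lambda$ denotes the induced length measure on $Q$, $\mu=\lambda(Q)$, and $d$ is the path-length metric; $P(x,y)$ is the path from $x$ to $y$. Write $x\preceq y$ if $x$ lies on $P(O,y)$, and $Q_x=\{y\in Q: x\preceq y\}$. A hiding distribution $h$ is a Borel probability measure on $Q$. For $R\subset Q$ with $\lambda(R)>0$ the search density is $\rho(R)=h(R)/\lambda(R)$. $h$ is monotone if $\rho(Q_x)\le\rho(Q_y)$ for all $x\preceq y$ (for which the densities are defined, i.e. $\lambda(Q_y)>0$). A search is a function $S:[0,\infty)\to Q$ with $S(0)=O$ and $d(S(t_1),S(t_2))\le t_2-t_1$ for $0\le t_1<t_2$; the behaviour of $S$ after all of $Q$ has been covered is irrelevant (disregarded). Put $T(S,x)=\min\{t\ge 0:S(t)=x\}$ (or $+\infty$) and $T(S,h)=\int_Q T(S,x)\,dh(x)$. A search is optimal against $h$ if it minimizes $T(S,h)$ over all searches (a minimizer exists). All searches considered are assumed normal: whenever $t_1<t_2$ and $S([t_1,t_2])=P(S(t_1),S(t_2))$, the search goes directly at unit speed from $S(t_1)$ to $S(t_2)$, i.e. for $0\le s\le t_2-t_1$, $S(t_1+s)$ is the point of $P(S(t_1),S(t_2))$ at distance $s$ from $S(t_1)$. A depth-first (DF) search is a sequence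 of arcs traversed at unit speed, starting and ending at $O$, such that when leaving a node the unique arc towards the root is chosen only if all the other arcs at the node have been traversed (so each arc is traversed exactly once in each direction). $h$ is simply searchable if some DF search is optimal, and strongly simply searchable if the only optimal searches are DF. *)

(* Defs.v *)
From HB Require Import structures.
From mathcomp Require Import all_boot all_order all_algebra.
From mathcomp Require Import all_classical all_reals all_analysis.

Set Implicit Arguments.
Unset Strict Implicit.
Unset Printing Implicit Defensive.

Import Order.TTheory GRing.Theory Num.Theory.

Local Open Scope classical_set_scope.
Local Open Scope ring_scope.

(* A finite rooted tree given by parent pointers.  Each node v other than the
   root stands also for the arc joining v to its parent, a segment of length
   [len v]; the values [parent root_node] and [len root_node] are mere conventions. *)
Record tree_network (R : realType) := TreeNetwork {
  node : finType;
  root_node : node;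
  parent : node -> node;
  len : node -> R;
  parent_root : parent root_node = root_node;
  parent_connect : forall v, fconnect parent v root_node;
  len_root : len root_node = 0;
  len_gt0 : forall v, v != root_node -> 0 < len v
}.

Section points.
Context {R : realType} (Q : tree_network R).

(* A point is a pair (v, s): the point of the arc v at distance s from the
   parent of v.  As s = 0 is allowed only for v = root_node, each point of the
   network has exactly one such representation. *)
Definition is_point (p : node Q * R) : bool :=
  if p.1 == root_node Q then p.2 == 0 else 0 < p.2 <= len p.1.

Definition location : Type := {p : node Q * R | is_point p}.

HB.instance Definition _ := Choice.on location.

Definition arc_of (x : location) : node Q := (val x).1.
Definition offset (x : location) : R := (val x).2.

Lemma node_is_point (v : node Q) : is_point (v, len v).
Proof.
rewrite /is_point/=; case: eqVneq => [->|v0]; first by rewrite len_root.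
by rewrite len_gt0 ?lexx.
Qed.

Definition at_node (v : node Q) : location := exist _ (v, len v) (node_is_point v).

HB.instance Definition _ := isPointed.Build location (at_node (root_node Q)).

(* The length of the part of the arc v lying between the root and x. *)
Definition covered (x : location) (v : node Q) : R :=
  if v == arc_of x then offset x
  else if fconnect (@parent R Q) (arc_of x) v then len v else 0.

(* The parts of the arc v lying between the root and x, resp. y, are nested, and
   their difference is the part of v on the path from x to y; summing over the
   arcs gives the length of this path. *)
Definition path_length (x y : location) : R :=
  \sum_(v | v != root_node Q) `|covered x v - covered y v|.

Lemma path_lengthxx x : path_length x x = 0.
Proof. by apply: big1 => v _; rewrite subrr normr0. Qed.

Lemma path_length_sym x y : path_length x y = path_length y x.
Proof. by apply: eq_bigr => v _; rewrite distrC. Qed.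

Lemma path_length_triangle y x z :
  path_length x z <= path_length x y + path_length y z.
Proof. by rewrite -big_split/=; apply: ler_sum => v _; exact: ler_distD. Qed.

Lemma iter_parent_root n : iter n (@parent R Q) (root_node Q) = root_node Q.
Proof. by elim: n => //= n ->; exact: parent_root. Qed.

Lemma parent_connect_anti (u v : node Q) :
  fconnect (@parent R Q) u v -> fconnect (@parent R Q) v u -> u = v.
Proof.
move=> /iter_findex; set a := findex _ _ _ => uv.
move=> /iter_findex; set b := findex _ _ _ => vu.
have [n vr] : exists n, iter n (@parent R Q) v = root_node Q.
  by exists (findex (@parent R Q) v (root_node Q)); exact/iter_findex/parent_connect.
have [ab0|ab_gt0] := posnP (a + b).
  by move/eqP: ab0; rewrite addn_eq0 => /andP[/eqP a0 _]; rewrite -uv a0.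
have vv k : iter (k * (a + b)) (@parent R Q) v = v.
  elim: k => // k IHk; rewrite mulSn iterD IHk iterD vu; exact: uv.
have v_root : v = root_node Q.
  have n_le : (n <= n * (a + b))%N by rewrite leq_pmulr.
  by rewrite -(vv n) -(subnK n_le) iterD vr iter_parent_root.
by rewrite -vu v_root iter_parent_root.
Qed.

Lemma path_length_positivity x y : path_length x y = 0 -> x = y.
Proof.
move=> /eqP; rewrite psumr_eq0; last by move=> v _; exact: normr_ge0.
move=> /allP covE.
have cov v : v != root_node Q -> covered x v = covered y v.
  move=> v0; have := covE v (mem_index_enum v).
  by rewrite v0 /= normr_eq0 subr_eq0 => /eqP.
have anc (p q : location) : (forall v, v != root_node Q -> covered p v = covered q v) ->
    arc_of p != root_node Q -> fconnect (@parent R Q) (arc_of q) (arc_of p).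
  move=> pq p0; have := pq _ p0; rewrite /covered eqxx.
  case: eqVneq => [->|_]; first by rewrite connect0.
  case: ifPn => // _ off0; have := valP p.
  by rewrite /is_point -/(arc_of p) -/(offset p) (negbTE p0) off0 ltxx.
have root_anc (v : node Q) : fconnect (@parent R Q) (root_node Q) v -> v = root_node Q.
  by move=> /iter_findex <-; rewrite iter_parent_root.
have arcE : arc_of x = arc_of y.
  have [x0|x0] := eqVneq (arc_of x) (root_node Q); last first.
    have yx := anc _ _ cov x0.
    have [y0|y0] := eqVneq (arc_of y) (root_node Q).
      by rewrite y0; apply: root_anc; rewrite -y0.
    apply/esym/parent_connect_anti => //.
    by apply: anc => // v /cov.
  have [->//|y0] := eqVneq (arc_of y) (root_node Q).
  by rewrite x0; apply/esym/root_anc; rewrite -x0; apply: anc => // v /cov.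
have offE : offset x = offset y.
  have [x0|x0] := eqVneq (arc_of x) (root_node Q).
    have := valP x; have := valP y; rewrite /is_point -/(arc_of x) -/(arc_of y).
    by rewrite -arcE x0 eqxx /offset => /eqP -> /eqP ->.
  by have := cov _ x0; rewrite /covered -arcE eqxx.
by apply: val_inj; rewrite [val x]surjective_pairing [val y]surjective_pairing;
  congr (_, _).
Qed.

HB.instance Definition _ := isMetric.Build R location path_lengthxx
  path_length_positivity path_length_sym path_length_triangle.

Definition origin : location := at_node (root_node Q).

(* In a tree the metric interval between two points is the path joining them. *)
Definition path_between (x y : location) : set location :=
  [set z | mdist x z + mdist z y = mdist x y].

Definition precedes (x y : location) : Prop := path_between origin y x.

Definition branch (x : location) : set location := [set y | precedes x y].

Definition length_measure (A : set location) : \bar R :=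
  (\sum_(v | v != root_node Q)
     lebesgue_measure (offset @` (A `&` [set x | arc_of x = v])))%E.

End points.

Notation borel Q := (g_sigma_algebraType (@open (location Q))).

Section searching.
Context {R : realType} {Q : tree_network R}.
Implicit Types (S : R -> location Q) (w : seq (node Q)).

Definition density (h : probability (borel Q) R) (A : set (location Q)) : R :=
  fine (h A) / fine (length_measure A).

Definition monotone_distribution (h : probability (borel Q) R) : Prop :=
  forall x y : location Q, precedes x y -> (0 < length_measure (branch y))%E ->
    density h (branch x) <= density h (branch y).

(* Here and below only the values S t with t >= 0 matter. *)
Definition covered_by S (t : R) : Prop :=
  forall x, exists2 s, 0 <= s <= t & S s = x.

(* t does not exceed the time at which S completes its tour of the network
   (any t if it never does). *)
Definition until_covered S (t : R) : Prop :=
  forall s, 0 <= s < t -> ~ covered_by S s.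

Definition goes_directly S (t1 t2 : R) : Prop :=
  forall s, 0 <= s <= t2 - t1 ->
    path_between (S t1) (S t2) (S (t1 + s)) /\ mdist (S t1) (S (t1 + s)) = s.

(* Normality is required only until the network is covered: afterwards the
   trajectory is irrelevant, and in general could not be continued normally
   (on a single arc, for instance). *)
Definition normal_search S : Prop :=
  forall t1 t2, 0 <= t1 -> t1 < t2 -> until_covered S t2 ->
    S @` `[t1, t2] = path_between (S t1) (S t2) -> goes_directly S t1 t2.

Definition search S : Prop :=
  [/\ S 0 = origin Q,
      forall t1 t2, 0 <= t1 -> t1 < t2 -> mdist (S t1) (S t2) <= t2 - t1
    & normal_search S].

(* The infimum is attained when S is continuous, and is +oo when S does not
   reach x. *)
Definition hitting_time S (x : location Q) : \bar R :=
  ereal_inf [set t%:E | t in [set t | 0 <= t /\ S t = x]].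

Definition expected_time S (h : probability (borel Q) R) : \bar R :=
  (\int[h]_x hitting_time S x)%E.

Definition optimal S (h : probability (borel Q) R) : Prop :=
  search S /\
  forall S', search S' -> (expected_time S h <= expected_time S' h)%E.

Definition adjacent (u v : node Q) : bool :=
  ((v != root_node Q) && (parent v == u)) || ((u != root_node Q) && (parent u == v)).

(* The walk through the nodes root_node, w_0, w_1, ... as a sequence of directed
   arcs. *)
Definition steps w : seq (node Q * node Q) := zip (root_node Q :: w) w.

Definition traversed (s : seq (node Q * node Q)) (v : node Q) : bool :=
  ((parent v, v) \in s) || ((v, parent v) \in s).

Definition depth_first_walk w : Prop :=
  [/\ path adjacent (root_node Q) w,
      last (root_node Q) w = root_node Q,
      forall v, v != root_node Q -> count_mem (parent v, v) (steps w) = 1%N /\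
                               count_mem (v, parent v) (steps w) = 1%N
    & forall i v, (i < size w)%N -> v != root_node Q ->
        nth (root_node Q, root_node Q) (steps w) i = (v, parent v) ->
        forall c, c != root_node Q -> parent c = v -> traversed (take i (steps w)) c].

Definition stop w (i : nat) : location Q := at_node (nth (root_node Q) (root_node Q :: w) i).

Definition arrival w (i : nat) : R :=
  \sum_(j < i) mdist (stop w j) (stop w j.+1).

Definition depth_first D : Prop := exists2 w, depth_first_walk w &
  (forall i, (i <= size w)%N -> D (arrival w i) = stop w i) /\
  (forall i, (i < size w)%N -> goes_directly D (arrival w i) (arrival w i.+1)).

Definition strongly_simply_searchable (h : probability (borel Q) R) : Prop :=
  forall S, optimal S h ->
    exists2 D, depth_first D & forall t, 0 <= t -> until_covered S t -> S t = D t.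

End searching.

(* Main.v *)
From HB Require Import structures.
From mathcomp Require Import all_boot all_order all_algebra.
From mathcomp Require Import all_classical all_reals all_analysis.
From mathcomp Require Import measurable_realfun lra ring zify.
Require Import Defs.

(** Why an optimal search is depth-first.

    Let S be a trajectory of unit speed. For each arc v, covered (S t) v is the length of the
    part of v between the root and S t, and explored S v t is its running maximum. The
    coordinate of v climbs to this maximum and then comes back, hence
      t >= 2 * (sum of the explored lengths at time t) - depth (S t).
    The difference of the two sides, waste S t, is the time lost by S. It is nondecreasing
    (waste_mono), and it becomes positive as soon as S returns to a branch that it has
    left (waste_reentry). A search that loses no time therefore explores sibling branches one
    after the other, each of them completely: its first visits follow the timetable of a
    depth-first search (wasteless_tour), and between first visits it can only go straight from
    one to the next (unique_search).

    It remains to show that an optimal search loses no time before everything is covered. When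
    S reaches x, the explored length includes the path to x and the explored parts of the
    branches that hang off this path, so the hitting time of x is at least the depth of x plus
    twice the explored lengths of these branches (explored_total_ge). Write L u and H u for the
    length and the mass of the branch of u. Monotonicity says that each remaining part of this
    branch is at least as dense as the branch, so that its explored length is at least
    L u / H u times its explored mass (explored_mass). Take the mean over x: two sibling
    branches u and w contribute L u / H u times the probability that a random point of u
    precedes an independent random point of w, plus the same with u and w exchanged. The two
    probabilities add up to H u * H w at least, as one of the points comes first
    (comparison_integral). The contribution is thus at least the smaller of L u * H w and
    L w * H u, which is what a depth-first search pays if it starts with the denser of the two
    branches. Sorting the children of each node by density attains all these bounds at once
    (tour_time_optimal).

    So the mean of the lower bound is the expected time of a search, and an optimal S must
    attain the lower bound at almost every x, which leaves no room for waste at the hitting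
    times of these points. As monotonicity gives a positive mass to the neighbourhood of each
    leaf, S loses no time until it has explored the whole network (tight_complete).

    The depth-first search of a given order of the children is built from its walk
    (tour_search); that it is normal is again a consequence of the absence of waste
    (wasteless_normal). *)

Set Implicit Arguments.
Unset Strict Implicit.
Unset Printing Implicit Defensive.

Import Order.TTheory GRing.Theory Num.Theory.
Import numFieldNormedType.Exports.
Local Open Scope classical_set_scope.
Local Open Scope ring_scope.

(** * Ancestors, children and siblings *)

Local Notation root := (root_node _).
Local Notation anc v z := (fconnect (@parent _ _) z v).

Section tree.
Context {R : realType} (Q : tree_network R).
Implicit Types (u v w z c : node Q) (x y p : location Q).

Lemma ancP v z : reflect (exists n, iter n (@parent R Q) z = v) (anc v z).
Proof.
apply: (iffP idP) => [/iter_findex <-|[n <-]]; first by eexists.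
exact: fconnect_iter.
Qed.

Lemma anc_refl v : anc v v. Proof. exact: connect0. Qed.

Lemma anc_trans v u z : anc v u -> anc u z -> anc v z.
Proof. by move=> vu uz; apply: connect_trans uz vu. Qed.

Lemma anc_parent v : anc (parent v) v. Proof. exact: fconnect1. Qed.

Lemma anc_root v : anc root v. Proof. exact: parent_connect. Qed.

Lemma anc_of_root v : anc v root -> v = root.
Proof. by case/ancP => n <-; rewrite iter_parent_root. Qed.

Lemma ancE v z : anc v z = (v == z) || (z != root) && anc v (parent z).
Proof.
apply/idP/orP => [/ancP[[|n] /=]|[/eqP->|/andP[_ vz]]]; last 2 first.
- exact: anc_refl.
- exact: anc_trans vz (anc_parent z).
- by move=> ->; left.
rewrite -iterS iterSr => E.
have [z0|z0] := eqVneq z root.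
  by left; rewrite -E z0 parent_root iter_parent_root.
by right; apply/ancP; exists n.
Qed.

Lemma anc_total v u z : anc v z -> anc u z -> anc v u || anc u v.
Proof.
case/ancP => n <- /ancP[m <-]; have [nm|/ltnW mn] := leqP n m; apply/orP.
- by right; rewrite -(subnK nm) iterD fconnect_iter.
- by left; rewrite -(subnK mn) iterD fconnect_iter.
Qed.

Lemma anc_root_neq v z : v != root -> anc v z -> z != root.
Proof. by move=> v0; apply: contraTneq => ->; apply: contra v0 => /anc_of_root ->. Qed.

Lemma anc_parent_neq c : c != root -> ~~ anc c (parent c).
Proof.
move=> c0; apply/negP => cp.
have E := parent_connect_anti cp (anc_parent c).
have : iter (findex (@parent R Q) c root) (@parent R Q) c = root.
  exact/iter_findex/anc_root.
have -> n : iter n (@parent R Q) c = c by elim: n => //= n ->.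
by move/eqP; apply/negP.
Qed.

Definition child v : pred (node Q) := [pred c | (c != root) && (parent c == v)].
Definition sibling w : pred (node Q) :=
  [pred u | [&& u != root, parent u == parent w & u != w]].

Lemma childP v c : reflect (c != root /\ parent c = v) (child v c).
Proof. by apply: (iffP andP) => -[? /eqP]. Qed.

Lemma siblingC u w : u != root -> w != root -> sibling w u = sibling u w.
Proof. by move=> u0 w0; rewrite /sibling/= u0 w0 eq_sym [u == w]eq_sym. Qed.

Lemma siblings_disjoint u w z : u != root -> w != root -> parent u = parent w ->
  u != w -> anc u z -> ~~ anc w z.
Proof.
move=> u0 w0 E uw uz; apply/negP => wz.
wlog wu : u w u0 w0 E uw uz wz / anc w u.
  move=> H; have /orP[] := anc_total uz wz; last exact: H.
  by apply: H => //; rewrite eq_sym.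
move: wu; rewrite ancE eq_sym (negbTE uw)/= E => /andP[_].
by apply/negP/anc_parent_neq.
Qed.

Lemma tree_ind_down (P : node Q -> Prop) :
  P root -> (forall v, v != root -> P (parent v) -> P v) -> forall v, P v.
Proof.
move=> P0 PS v; have /ancP[n] := anc_root v.
elim: n v => [|n IH] v /=; first by move=> ->.
rewrite -iterS iterSr => /IH.
by have [->//|v0] := eqVneq v root; apply: PS.
Qed.

Lemma tree_ind_up (P : node Q -> Prop) :
  (forall v, (forall c, child v c -> P c) -> P v) -> forall v, P v.
Proof.
move=> PS v; have [n] := ubnP #|[pred z | anc v z]|.
elim: n v => // n IH v /ltnSE vn; apply: PS => c /childP[c0 cv].
apply: IH; apply: leq_trans vn; apply: proper_card; apply/properP; split=> /=.
  by apply/(fintype.subsetP) => z; rewrite !inE; apply: anc_trans; rewrite -cv anc_parent.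
by exists v; rewrite !inE ?anc_refl// -cv anc_parent_neq.
Qed.

Lemma anc_child v z : anc v z -> z != v -> exists2 c, child v c & anc c z.
Proof.
move=> vz zv; have /ancP[n] := vz; elim: n z vz zv => [z _ /eqP//|n IH z vz zv].
rewrite iterSr => E; have [pv|pv] := eqVneq (parent z) v.
  exists z; last exact: anc_refl.
  by apply/childP; split=> //; apply: contra zv => /eqP z0; rewrite -pv z0 parent_root.
have [|c cv cz] := IH _ _ pv E; first by apply/ancP; exists n.
by exists c => //; exact: anc_trans cz (anc_parent z).
Qed.

Section sums.
Variables (f : node Q -> R).

Definition branch_sum u : R := \sum_(z | anc u z) f z.

(** A node strictly beyond v lies beyond exactly one child of v. *)
Lemma branch_sum_rec v :
  branch_sum v = f v + \sum_(c | child v c) branch_sum c.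
Proof.
rewrite /branch_sum (bigD1 v) ?anc_refl//=; congr (_ + _).
under [RHS]eq_bigr do rewrite big_mkcond.
rewrite exchange_big/= [LHS]big_mkcond; apply: eq_bigr => z _.
case: ifPn => [/andP[vz zv]|]; last first.
  rewrite negb_and negbK => /orP vz; rewrite big1// => c /childP[c0 cv].
  case: ifP => // cz; case: vz => [|/eqP zv].
    by rewrite (anc_trans _ cz)// -cv anc_parent.
  by move: cz; rewrite zv -cv (negbTE (anc_parent_neq c0)).
have [c cv cz] := anc_child vz zv.
rewrite (bigD1 c)//= cz big1 ?addr0// => c' /andP[/childP[c0' cv'] cc'].
case/childP: cv => c0 cv.
by rewrite (negbTE (@siblings_disjoint c c' _ _ _ _ _ _))// ?cv// eq_sym.
Qed.

Lemma branch_sum_root : branch_sum root = f root + \sum_(v | v != root) f v.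
Proof.
rewrite /branch_sum (bigD1 root) ?anc_refl//=; congr (_ + _).
by apply: eq_bigl => v; rewrite anc_root.
Qed.

Lemma sum_anc_step (g : node Q -> R) v : v != root ->
  \sum_(z | (z != root) && anc z v) g z =
  g v + \sum_(z | (z != root) && anc z (parent v)) g z.
Proof.
move=> v0; rewrite (bigD1 v) ?v0 ?anc_refl//=; congr (_ + _).
apply: eq_bigl => z; rewrite [anc z v]ancE v0 /=.
by case: (eqVneq z v) => [->|zv] /=; rewrite ?andbT// (negbTE (anc_parent_neq v0)) !andbF.
Qed.

Lemma sum_anc_root (g : node Q -> R) :
  \sum_(z | (z != root) && anc z root) g z = 0.
Proof. by rewrite big_pred0// => z; case: eqVneq => //= z0; apply: contraNF z0 => /anc_of_root ->. Qed.

(** The nodes other than the root are either ancestors of v, or lie beyond a child of v,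
    or lie in the branch of exactly one node u that is a sibling of an ancestor of v. *)
Lemma sum_decomposition v :
  \sum_(z | z != root) f z =
  \sum_(z | (z != root) && anc z v) f z + \sum_(c | child v c) branch_sum c
  + \sum_(w | (w != root) && anc w v) \sum_(u | sibling w u) branch_sum u.
Proof.
elim/tree_ind_down: v => [|v v0 ->].
  rewrite !sum_anc_root add0r addr0.
  by apply: (@addrI _ (f root)); rewrite -branch_sum_root branch_sum_rec.
rewrite [in RHS]sum_anc_step// [X in _ = _ + X]sum_anc_step//.
have -> : \sum_(c | child (parent v) c) branch_sum c =
    branch_sum v + \sum_(u | sibling v u) branch_sum u.
  rewrite (bigD1 v)/=; last exact/childP.
  by congr (_ + _); apply: eq_bigl => u; rewrite -andbA.
by rewrite (branch_sum_rec v); ring.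
Qed.

End sums.
End tree.

(** * Points of the network *)

Section location.
Context {R : realType} (Q : tree_network R).
Implicit Types (u v w z c : node Q) (x y p : location Q).

Lemma mdistE x y : mdist x y = \sum_(v | v != root) `|covered x v - covered y v|.
Proof. by []. Qed.

Lemma offset_itv x : arc_of x != root -> 0 < offset x <= len (arc_of x).
Proof. by move=> x0; have := valP x; rewrite /is_point (negbTE x0). Qed.

Lemma offset_root x : arc_of x = root -> offset x = 0.
Proof. by move=> x0; have := valP x; rewrite /is_point -/(arc_of x) x0 eqxx => /eqP. Qed.

Lemma len_ge0 v : 0 <= len v.
Proof. by have [->|/len_gt0/ltW//] := eqVneq v root; rewrite len_root. Qed.

Lemma covered_arc x : covered x (arc_of x) = offset x.
Proof. by rewrite /covered eqxx. Qed.

Lemma covered_itv x v : 0 <= covered x v <= len v.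
Proof.
rewrite /covered; case: eqVneq => [->|_].
  have [x0|/offset_itv/andP[/ltW-> ->//]] := eqVneq (arc_of x) root.
  by rewrite offset_root// x0 len_root lexx.
by case: ifP; rewrite ?len_ge0 lexx.
Qed.

Lemma covered_ge0 x v : 0 <= covered x v.
Proof. by case/andP: (covered_itv x v). Qed.

Lemma covered_le_len x v : covered x v <= len v.
Proof. by case/andP: (covered_itv x v). Qed.

Lemma covered_gt0 x v : v != root -> (0 < covered x v) = anc v (arc_of x).
Proof.
move=> v0; rewrite /covered; case: eqVneq => [vE|_].
  by rewrite vE anc_refl; move: v0; rewrite vE => /offset_itv/andP[->].
by case: ifP; rewrite ?ltxx// len_gt0.
Qed.

Lemma covered_eq0 x v : v != root -> ~~ anc v (arc_of x) -> covered x v = 0.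
Proof.
move=> v0; rewrite -covered_gt0// -leNgt => cov.
by apply/eqP; rewrite eq_le cov covered_ge0.
Qed.

Lemma covered_full x v : anc v (arc_of x) -> v != arc_of x -> covered x v = len v.
Proof. by rewrite /covered => -> /negbTE ->. Qed.

Lemma covered_anc x v z : z != root -> 0 < covered x z -> anc v z -> v != z ->
  covered x v = len v.
Proof.
move=> z0; rewrite covered_gt0// => zx vz nvz; apply: covered_full.
  exact: anc_trans zx.
apply: contra nvz => /eqP E; apply/eqP/parent_connect_anti => //.
by rewrite E.
Qed.

Lemma arc_of_node v : arc_of (at_node v) = v. Proof. by []. Qed.
Lemma offset_node v : offset (at_node v) = len v. Proof. by []. Qed.

Lemma covered_node v z : z != root -> covered (at_node v) z = if anc z v then len z else 0.
Proof.
move=> z0; rewrite /covered arc_of_node; case: eqVneq => [->|//].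
by rewrite anc_refl offset_node.
Qed.

Lemma covered_origin z : covered (origin Q) z = 0.
Proof.
rewrite /origin; have [->|z0] := eqVneq z root.
  by rewrite /covered arc_of_node eqxx offset_node len_root.
rewrite covered_node//; case: ifP => // /anc_of_root E.
by rewrite E eqxx in z0.
Qed.

Definition depth x : R := \sum_(v | v != root) covered x v.

Lemma depth_origin : depth (origin Q) = 0.
Proof. by rewrite /depth big1// => v _; rewrite covered_origin. Qed.

Lemma mdist_origin x : mdist (origin Q) x = depth x.
Proof.
rewrite mdistE; apply: eq_bigr => v _.
by rewrite covered_origin sub0r normrN ger0_norm ?covered_ge0.
Qed.

Lemma le_covered_mdist x y v : v != root -> `|covered x v - covered y v| <= mdist x y.
Proof.
move=> v0; rewrite mdistE (bigD1 v)//= lerDl.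
by apply: sumr_ge0 => z _; exact: normr_ge0.
Qed.

Lemma depth_lip x y : `|depth x - depth y| <= mdist x y.
Proof. by rewrite /depth -sumrB mdistE; apply: ler_norm_sum. Qed.

Lemma covered_inj x y : (forall v, v != root -> covered x v = covered y v) -> x = y.
Proof.
move=> E; apply: path_length_positivity; apply: big1 => v v0.
by rewrite E// subrr normr0.
Qed.

(** Used on triangle inequalities and on depths, to pass from an equality of lengths of
    paths to equalities arc by arc. *)
Lemma sum_eq_termwise (P : pred (node Q)) (f g : node Q -> R) :
  (forall v, P v -> g v <= f v) -> \sum_(v | P v) f v <= \sum_(v | P v) g v ->
  forall v, P v -> f v = g v.
Proof.
move=> gf fg v Pv; apply/eqP; rewrite eq_le gf// andbT -subr_le0.
apply: le_trans (_ : \sum_(v | P v) (f v - g v) <= 0); last by rewrite sumrB subr_le0.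
rewrite (bigD1 v)//= lerDl; apply: sumr_ge0 => z /andP[Pz _].
by rewrite subr_ge0 gf.
Qed.

Lemma betweenP x y (z : location Q) : mdist x z + mdist z y <= mdist x y ->
  forall v, v != root ->
  `|covered x v - covered z v| + `|covered z v - covered y v| = `|covered x v - covered y v|.
Proof.
rewrite !mdistE -big_split/= => H v v0.
by apply: (sum_eq_termwise _ H v0) => u u0; exact: ler_distD.
Qed.

Lemma precedesP x y : precedes x y <-> forall v, v != root -> covered x v <= covered y v.
Proof.
rewrite /precedes /path_between/=; split.
  move=> E v v0; have := @betweenP (origin Q) y x; rewrite E => /(_ (lexx _) v v0).
  rewrite !covered_origin !sub0r !normrN.
  rewrite (ger0_norm (covered_ge0 x v)) (ger0_norm (covered_ge0 y v)).
  by have := normr_ge0 (covered x v - covered y v); lra.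
move=> H; rewrite !mdist_origin mdistE /depth -big_split/=; apply: eq_bigr => v v0.
by rewrite distrC ger0_norm ?subr_ge0 ?H//; ring.
Qed.

(** Ancestry of points can be tested on a single arc: a point that covers a positive
    part of the arc of x covers all the ancestors of this arc. *)
Lemma precedesE x y : arc_of x != root ->
  precedes x y <-> offset x <= covered y (arc_of x).
Proof.
move=> x0; rewrite precedesP; split=> [/(_ _ x0)|H v v0].
  by rewrite covered_arc.
have [->|vx] := eqVneq v (arc_of x); first by rewrite covered_arc.
have [vax|vax] := boolP (anc v (arc_of x)); last by rewrite covered_eq0 ?covered_ge0.
have c0 : 0 < covered y (arc_of x).
  by apply: lt_le_trans H; case/andP: (offset_itv x0).
by rewrite (covered_anc x0 c0)// covered_le_len.
Qed.

Lemma precedes_total x y p : precedes x p -> precedes y p -> precedes x y \/ precedes y x.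
Proof.
have rootP (q q' : location Q) : arc_of q = root -> precedes q q'.
  move=> q0; apply/precedesP => v v0.
  rewrite (_ : covered q v = 0) ?covered_ge0// covered_eq0// q0.
  by apply: contra v0 => /anc_of_root ->.
have [x0|x0] := eqVneq (arc_of x) root; first by left; exact: rootP.
have [y0|y0] := eqVneq (arc_of y) root; first by right; exact: rootP.
move=> xp yp.
have xp' : anc (arc_of x) (arc_of p).
  rewrite -covered_gt0//; have /(precedesE _ x0) := xp; apply: lt_le_trans.
  by case/andP: (offset_itv x0).
have yp' : anc (arc_of y) (arc_of p).
  rewrite -covered_gt0//; have /(precedesE _ y0) := yp; apply: lt_le_trans.
  by case/andP: (offset_itv y0).
wlog xy : x y x0 y0 xp yp xp' yp' / anc (arc_of x) (arc_of y).
  move=> H; case/orP: (anc_total xp' yp') => [xy|yx]; first exact: H xy.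
  by have := H y x y0 x0 yp xp yp' xp' yx; tauto.
have [E|nE] := eqVneq (arc_of x) (arc_of y).
  have [xy'|/ltW yx'] := leP (offset x) (offset y); [left|right].
    by rewrite precedesE// E covered_arc.
  by rewrite precedesE// -E covered_arc.
left; rewrite precedesE// covered_full//.
by case/andP: (offset_itv x0).
Qed.

Lemma precedes_depth_inj x y p : precedes x p -> precedes y p -> depth x = depth y -> x = y.
Proof.
move=> xp yp; wlog xy : x y xp yp / precedes x y.
  move=> H E; case: (precedes_total xp yp) => [|yx]; first by move/H; exact.
  exact/esym/H.
move=> E; apply: covered_inj => v v0; apply/esym.
apply: (@sum_eq_termwise _ (covered y) (covered x)) v0; first exact/precedesP.
by move: E; rewrite /depth => ->.
Qed.

(** When s is not in the interval from 0 (excluded) to the length of v, this is the end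
    node of v. *)
Definition point v (s : R) : location Q := insubd (at_node v) (v, s).

Lemma arc_of_point v s : arc_of (point v s) = v.
Proof. by rewrite /arc_of /point val_insubd; case: ifP. Qed.

Lemma offset_point v s : v != root -> 0 < s <= len v -> offset (point v s) = s.
Proof. by move=> v0 s0; rewrite /offset /point val_insubd /is_point/= (negbTE v0) s0. Qed.

Lemma point_arc x : point (arc_of x) (offset x) = x.
Proof.
case: x => -[v s] xP; apply: val_inj; rewrite /point val_insubd.
by rewrite /arc_of /offset /= xP.
Qed.

Lemma point_len v : v != root -> point v (len v) = at_node v.
Proof. by move=> v0; rewrite -[RHS]point_arc. Qed.

End location.

(** * Unit-speed trajectories and the explored part of the network *)

Section search.
Context {R : realType} {Q : tree_network R}.
Implicit Types (u v w z c : node Q) (x y : location Q) (S : R -> location Q).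

Definition unit_speed S : Prop :=
  S 0 = origin Q /\ forall t1 t2, 0 <= t1 -> t1 < t2 -> mdist (S t1) (S t2) <= t2 - t1.

Definition visited S (t : R) x : Prop := exists2 s, 0 <= s <= t & S s = x.

Definition explored S v (t : R) : R := sup [set covered (S s) v | s in `[0, t]].

(** A trajectory that has explored a length k of the network and stands at depth d has
    traversed each explored part of the network twice, except the path from the root to its
    position: this takes the time 2 * k - d at least. *)
Definition waste S (t : R) : R :=
  t - 2 * \sum_(v | v != root) explored S v t + depth (S t).

Lemma nonexpansive_continuous (g : R -> R) :
  (forall s t, `|g s - g t| <= `|s - t|) -> continuous g.
Proof.
move=> gl s; apply/cvgrPdist_le => e e0; near=> t.
apply: le_trans (gl s t) _; near: t.
by apply: (@cvgr_dist_le _ _ _ _ _ id) => //; exact: cvg_id.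
Unshelve. all: by end_near. Qed.

Section fixed_search.
Variable S : R -> location Q.
Hypothesis speedS : unit_speed S.

Lemma speed s t : 0 <= s <= t -> mdist (S s) (S t) <= t - s.
Proof.
case/andP => s0; rewrite le_eqVlt => /predU1P[->|st]; last exact: speedS.2.
by rewrite subrr mdistxx.
Qed.

Section nonexpansive.
Variable f : location Q -> R.
Hypothesis fl : forall x y, `|f x - f y| <= mdist x y.

Lemma nonexpansive_path_continuous : continuous (fun t : R => f (S (Num.max 0 t)) : R).
Proof.
apply: nonexpansive_continuous => s t; wlog st : s t / s <= t.
  move=> H; have [/H//|/ltW ts] := leP s t.
  by rewrite distrC [leRHS]distrC H.
apply: le_trans (fl _ _) _; apply: le_trans (speed _) _.
  by rewrite le_max lexx/= ge_max !le_max lexx st !orbT.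
rewrite [leRHS]distrC ger0_norm ?subr_ge0//.
by have [s0|s0] := leP 0 s; have [t0|t0] := leP 0 t; lra.
Qed.

Lemma nonexpansive_path_EVT s t : 0 <= s <= t ->
  exists2 q, s <= q <= t & forall p, s <= p <= t -> f (S p) <= f (S q).
Proof.
case/andP => s0 st.
have [q] := EVT_max st (continuous_subspaceT nonexpansive_path_continuous).
rewrite in_itv/= => qi H; exists q => // p pi.
have := H p; rewrite in_itv/= => /(_ pi).
have [q0 p0] : 0 <= q /\ 0 <= p by lra.
by rewrite !max_r.
Qed.

Lemma nonexpansive_path_IVT t a : 0 <= t -> f (S 0) <= a <= f (S t) ->
  exists2 s, 0 <= s <= t & f (S s) = a.
Proof.
move=> t0 /andP[fa af].
have [|s] := @IVT _ _ _ _ a t0 (continuous_subspaceT nonexpansive_path_continuous).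
  by rewrite maxxx (max_r t0) ge_min fa le_max af orbT.
rewrite in_itv/= => si; have /andP[s0 _] := si.
by rewrite max_r// => <-; exists s.
Qed.

End nonexpansive.

Lemma covered_max v s t : v != root -> 0 <= s <= t ->
  exists2 q, s <= q <= t & forall p, s <= p <= t -> covered (S p) v <= covered (S q) v.
Proof.
move=> v0; apply: (@nonexpansive_path_EVT (fun x => covered x v)) => x y.
exact: le_covered_mdist.
Qed.

Lemma explored_attained v t : v != root -> 0 <= t ->
  exists2 q, 0 <= q <= t & covered (S q) v = explored S v t /\
    forall p, 0 <= p <= t -> covered (S p) v <= explored S v t.
Proof.
move=> v0 t0; have [|q qt H] := @covered_max v 0 t v0; first by rewrite lexx.
suff E : covered (S q) v = explored S v t.
  by exists q => //; split=> // p; rewrite -E; exact: H.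
apply/eqP; rewrite eq_le; apply/andP; split.
  apply: ub_le_sup; last by exists q => //=; rewrite in_itv.
  by exists (len v) => _ [p _ <-]; exact: covered_le_len.
apply: ge_sup; first by exists (covered (S q) v), q => //=; rewrite in_itv.
by move=> _ [p + <-]; rewrite /= in_itv => /H.
Qed.

Lemma le_explored v p t : v != root -> 0 <= p <= t -> covered (S p) v <= explored S v t.
Proof.
move=> v0 pt; have [|q _ [_]] := @explored_attained v t v0; last exact.
by case/andP: pt; exact: le_trans.
Qed.

Lemma explored_itv v t : v != root -> 0 <= t -> 0 <= explored S v t <= len v.
Proof.
move=> v0 t0; have [q _ [<- _]] := explored_attained v0 t0; exact: covered_itv.
Qed.

Lemma explored_mono v s t : v != root -> 0 <= s <= t -> explored S v s <= explored S v t.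
Proof.
move=> v0 /andP[s0 st]; have [q /andP[q0 qs] [<- _]] := explored_attained v0 s0.
by apply: le_explored => //; rewrite q0 (le_trans qs).
Qed.

(** A point beyond x can only be reached through x. The proof applies the intermediate
    value theorem to the distance from the start of the arc of x, counted within the branch
    of this arc; the coordinate of the single arc would not do when x is its end node. *)
Lemma visitedP x t : arc_of x != root -> 0 <= t ->
  visited S t x <-> offset x <= explored S (arc_of x) t.
Proof.
move=> x0 t0; split=> [[s st E]|].
  subst x.
  by rewrite -(covered_arc (S s)); exact: le_explored.
set v := arc_of x in x0 *; have [q /andP[q0 qt] [<- _]] := explored_attained x0 t0.
pose f y : R := \sum_(z | anc v z) covered y z.
have f_neq z : anc v z -> z != root by exact: anc_root_neq.
have fE y : f y = covered y v + \sum_(z | anc v z && (z != v)) covered y z.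
  by rewrite /f (bigD1 v) ?anc_refl.
have fl y y' : `|f y - f y'| <= mdist y y'.
  rewrite /f -sumrB mdistE; apply: le_trans (ler_norm_sum _ _ _) _.
  rewrite [leRHS](bigID (fun z => anc v z))/= -[leLHS]addr0; apply: lerD; last exact: sumr_ge0.
  by rewrite le_eqVlt; apply/orP; left; apply/eqP/eq_bigl => z;
    case: (boolP (anc v z)) => [/f_neq ->|_]; rewrite ?andbF.
move=> xq; have /andP[off0 offl] := offset_itv x0.
have [|s /andP[s0 sq] fs] := @nonexpansive_path_IVT f fl q (offset x) q0.
  rewrite speedS.1 /f big1 => [|z _]; last exact: covered_origin.
  rewrite ltW//= (le_trans xq)// -/(f _) fE lerDl sumr_ge0// => z _.
  exact: covered_ge0.
exists s; first by rewrite s0 (le_trans sq).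
have [sv|sv] := eqVneq (arc_of (S s)) v.
  rewrite -[LHS]point_arc -[RHS]point_arc sv -/v; congr point.
  rewrite -fs fE -{1}covered_arc sv big1 ?addr0// => z /andP[vz zv].
  rewrite covered_eq0// ?f_neq// sv; apply: contra zv => zv.
  by rewrite (parent_connect_anti vz zv).
have /existsP[z /andP[vz cz]] : [exists z, anc v z && (0 < covered (S s) z)].
  apply: contraTT off0; rewrite negb_exists -leNgt -fs => /forallP H.
  by apply: sumr_le0 => z vz; have := H z; rewrite vz/= -leNgt.
have z0 := f_neq _ vz; move: (cz); rewrite covered_gt0// => zs.
have vs := anc_trans vz zs.
have : len v < f (S s).
  rewrite fE covered_full// 1?eq_sym// ltrDl (bigD1 (arc_of (S s)))/= ?vs//.
  rewrite covered_arc ltr_wpDr//; last by case/andP: (offset_itv (f_neq _ vs)).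
  by apply: sumr_ge0 => y _; exact: covered_ge0.
by rewrite fs ltNge offl.
Qed.

End fixed_search.
End search.

(** * The time lost by a trajectory *)

Section waste.
Context {R : realType} {Q : tree_network R}.
Implicit Types (u v w z c : node Q) (x y : location Q) (S : R -> location Q).

Variable S : R -> location Q.
Hypothesis speedS : unit_speed S.

(** The trajectory may move in only one arc at a time, at unit speed. By induction on the
    number of p v that are interior to the interval, which is split at one of them; the
    points p v of the other arcs are then truncated to each of the two halves. *)
Lemma variation_le s t (p : node Q -> R) : 0 <= s <= t -> (forall v, s <= p v <= t) ->
  \sum_(v | v != root) (`|covered (S s) v - covered (S (p v)) v| +
                        `|covered (S (p v)) v - covered (S t) v|) <= t - s.
Proof.
have [n] := ubnP #|[pred v | s < p v < t]|; elim: n s t p => // n IH s t p pn st pst.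
have [v0 v0st|none] := pickP [pred v | s < p v < t]; last first.
  apply: le_trans (speed speedS st); rewrite mdistE; apply: ler_sum => v _.
  have := none v; rewrite /= !lt_neqAle; have /andP[-> ->] := pst v; rewrite !andbT.
  by case: eqVneq => [<- _|_ /= /negbFE/eqP ->]; rewrite subrr normr0 ?add0r ?addr0.
(* split at the time chosen for v0, which is then interior to neither half *)
pose q := p v0; have /andP[sq qt] : s < q < t := v0st.
have smaller (a b : R) (p' : node Q -> R) : ~~ (a < p' v0 < b) ->
    (forall v, a < p' v < b -> s < p v < t) ->
    (#|[pred v | (a < p' v < b)%R]| < n)%N.
  move=> nv0 sub; apply: leq_trans (ltnSE pn); apply: proper_card.
  apply/properP; split; first by apply/fintype.subsetP => v; rewrite !inE; exact: sub.
  by exists v0; rewrite !inE.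
have H1 : \sum_(v | v != root) (`|covered (S s) v - covered (S (Num.min (p v) q)) v| +
    `|covered (S (Num.min (p v) q)) v - covered (S q) v|) <= q - s.
  apply: (IH s q (fun v => Num.min (p v) q)).
  - apply: smaller => [|v]; first by rewrite minxx ltxx andbF.
    by have := pst v; case: (leP (p v) q) => ? ?; lra.
  - by case/andP: st => ->; lra.
  - by move=> v; have := pst v; case: (leP (p v) q) => ? ?; lra.
have H2 : \sum_(v | v != root) (`|covered (S q) v - covered (S (Num.max (p v) q)) v| +
    `|covered (S (Num.max (p v) q)) v - covered (S t) v|) <= t - q.
  apply: (IH q t (fun v => Num.max (p v) q)).
  - apply: smaller => [|v]; first by rewrite maxxx ltxx.
    by have := pst v; case: (leP (p v) q) => ? ?; lra.
  - by case/andP: st => ?; lra.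
  - by move=> v; have := pst v; case: (leP (p v) q) => ? ?; lra.
apply: le_trans (_ : (q - s) + (t - q) <= _); last by lra.
apply: le_trans (lerD H1 H2); rewrite -big_split/=; apply: ler_sum => v _.
have := ler_distD (covered (S q) v) (covered (S (p v)) v) (covered (S t) v).
have := ler_distD (covered (S q) v) (covered (S s) v) (covered (S (p v)) v).
by case: (leP (p v) q) => _; rewrite subrr normr0; lra.
Qed.

(** The coordinate of the arc v climbs to its maximum and comes back, whence twice this
    maximum minus the two end values. *)
Lemma exploration_step s t : 0 <= s <= t -> exists2 M : node Q -> R,
  forall v, v != root -> [/\ covered (S s) v <= M v, covered (S t) v <= M v
    & explored S v t <= Num.max (explored S v s) (M v)]
  & \sum_(v | v != root) (2 * M v - covered (S s) v - covered (S t) v) <= t - s.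
Proof.
move=> st; have /andP[s0 st'] := st.
have /choice[p pP] : forall v, exists q, s <= q <= t /\
    (v != root -> forall q', s <= q' <= t -> covered (S q') v <= covered (S q) v).
  move=> v.
  have [->|v0] := eqVneq v root; first by exists s; rewrite lexx st'.
  by have [q qst H] := covered_max speedS v0 st; exists q.
exists (fun v => covered (S (p v)) v) => [v v0|].
  have [_ /(_ v0) pv] := pP v; split; [by apply: pv; rewrite lexx|by apply: pv; rewrite lexx st'|].
  - have [|q /andP[q0 qt] [<- _]] := @explored_attained _ _ _ speedS v t v0.
      exact: le_trans st'.
    rewrite le_max; apply/orP; have [qs|/ltW sq] := leP q s; [left|right].
      by apply: le_explored => //; rewrite q0.
    by apply: pv; rewrite sq.
apply: le_trans (variation_le st (fun v => (pP v).1)); apply: ler_sum => v v0.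
have [_ /(_ v0) pv] := pP v.
have /pv H1 : s <= s <= t by rewrite lexx.
have /pv H2 : s <= t <= t by rewrite st' lexx.
rewrite distrC !ger0_norm ?subr_ge0//; lra.
Qed.

Lemma waste_sub s t : waste S t - waste S s = (t - s) -
  \sum_(v | v != root) (2 * (explored S v t - explored S v s) - covered (S t) v + covered (S s) v).
Proof.
rewrite /waste /depth big_split/= sumrB -mulr_sumr sumrB; ring.
Qed.

Lemma waste_mono s t : 0 <= s <= t -> waste S s <= waste S t.
Proof.
move=> st; rewrite -subr_ge0 waste_sub subr_ge0.
have [M MP] := exploration_step st; apply: le_trans; apply: ler_sum => v v0.
have [H1 H2 H3] := MP v v0.
have cs : covered (S s) v <= explored S v s.
  by apply: le_explored => //; case/andP: st => ->; rewrite lexx.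
by move: H3; rewrite le_max => /orP[] ?; lra.
Qed.

Lemma explored0 v : v != root -> explored S v 0 = 0.
Proof.
move=> v0; have [q /andP[q0 q0'] [<- _]] := explored_attained speedS v0 (lexx 0).
have -> : q = 0 by lra.
by rewrite speedS.1 covered_origin.
Qed.

Lemma waste0 : waste S 0 = 0.
Proof.
rewrite /waste speedS.1 depth_origin big1 ?mulr0 ?subrr ?addr0// => v.
exact: explored0.
Qed.

Lemma waste_ge0 t : 0 <= t -> 0 <= waste S t.
Proof. by move=> t0; rewrite -waste0 waste_mono// lexx. Qed.

(** Coming back to a branch that has been entered before requires to traverse once more
    the beginning of its first arc. *)
Lemma waste_reentry u p q t : u != root -> 0 <= p -> p <= q -> q <= t ->
  0 < covered (S p) u -> covered (S q) u = 0 -> 0 < covered (S t) u -> 0 < waste S t.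
Proof.
move=> u0 p0 pq qt cp cq ct.
have q0 : 0 <= q by exact: le_trans pq.
have qt' : 0 <= q <= t by rewrite q0.
apply: le_lt_trans (waste_ge0 q0) _; rewrite -subr_gt0 waste_sub subr_gt0.
have [M MP] := exploration_step qt'; apply: lt_le_trans.
have cs v : v != root -> covered (S q) v <= explored S v q.
  by move=> v0; apply: le_explored => //; rewrite q0 lexx.
rewrite (bigD1 u)//= [ltRHS](bigD1 u)//=; apply: ltr_leD; last first.
  apply: ler_sum => v /andP[v0 _]; have [H1 H2 H3] := MP v v0; have := cs v v0.
  by move: H3; rewrite le_max => /orP[] ? ?; lra.
have [H1 H2 H3] := MP u u0.
have : covered (S p) u <= explored S u q by apply: le_explored => //; rewrite p0.
by move: H3; rewrite le_max => /orP[] ? ?; lra.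
Qed.

(** A Lipschitz bound, used to show that the times without waste form a closed set. *)
Lemma waste_growth s t : 0 <= s <= t -> waste S t <= waste S s + 2 * (t - s).
Proof.
move=> st; have := depth_lip (S s) (S t); have := speed speedS st.
have : \sum_(v | v != root) explored S v s <= \sum_(v | v != root) explored S v t.
  by apply: ler_sum => v v0; exact: explored_mono.
rewrite /waste ler_norml; lra.
Qed.

End waste.

(** * First visits *)

Section first_visits.
Context {R : realType} {Q : tree_network R}.
Implicit Types (u v w z c : node Q) (x y : location Q) (S D : R -> location Q).

Lemma depthE x : depth x = \sum_(z | (z != root) && anc z (arc_of x)) covered x z.
Proof.
rewrite /depth (bigID (fun z => anc z (arc_of x)))/= [X in _ + X]big1 ?addr0//.
by move=> z /andP[z0 zx]; rewrite covered_eq0.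
Qed.

(** Going to p from x at the price of the difference of depths only is going straight
    towards the root. *)
Lemma precedes_of_depth x p : mdist x p <= depth x - depth p -> precedes p x.
Proof.
rewrite mdistE /depth -sumrB => H; apply/precedesP => v v0.
rewrite -subr_ge0.
have <- := @sum_eq_termwise _ _ (fun v => v != root)
  (fun v => `|covered x v - covered p v|) (fun v => covered x v - covered p v) _ H v v0.
  exact: normr_ge0.
by move=> z _; exact: ler_norm.
Qed.

Lemma covered_point v s : v != root -> 0 < s <= len v -> covered (point v s) v = s.
Proof. by move=> v0 sv; rewrite -{2}(offset_point v0 sv) -covered_arc arc_of_point. Qed.

Section one_search.
Variable S : R -> location Q.
Hypothesis speedS : unit_speed S.

Lemma first_visit x t : visited S t x ->
  exists2 T, 0 <= T <= t & S T = x /\ forall s, 0 <= s -> S s = x -> T <= s.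
Proof.
case=> s0 /andP[s00 s0t] Ss0; pose A := [set s | 0 <= s /\ S s = x].
have A0 : A s0 by [].
have infA : has_inf A by split; [exists s0|exists 0 => s []].
have T0 : 0 <= inf A by apply: lb_le_inf; [exists s0|move=> s []].
have Tle s : 0 <= s -> S s = x -> inf A <= s.
  by move=> ? ?; apply: ge_inf => //; exists 0 => ? [].
exists (inf A); first by rewrite T0 (le_trans _ s0t)// Tle.
split=> //; apply: mdist_positivity; apply/eqP; rewrite eq_le mdist_ge0 andbT.
apply/ler_addgt0Pl => e e0; rewrite addr0.
have [s [s_ge0 Ss] se] := inf_adherent e0 infA.
have := @speed _ _ _ speedS (inf A) s; rewrite T0 Tle// Ss => /(_ isT).
by move=> /le_trans; apply; rewrite lerBlDl ltW// addrC.
Qed.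

(** The infimum that defines the hitting time is attained, because a trajectory is
    continuous. *)
Lemma hitting_timeP x t : 0 <= t -> (hitting_time S x <= t%:E)%E <-> visited S t x.
Proof.
move=> t0; split=> [H|[s /andP[s0 st] Ss]]; last first.
  by apply: (@le_trans _ _ s%:E); [apply: ereal_inf_lbound; exists s|rewrite lee_fin].
have [s s1] : exists2 s, 0 <= s & S s = x.
  apply: contrapT => none; move: H; rewrite /hitting_time.
  rewrite (_ : [set _ | _ in _] = set0) ?ereal_inf0//.
  by apply/seteqP; split => // y [s [s0 Ss] sy]; apply: none; exists s.
move=> Ss; have [|T /andP[T0 _] [ST Tmin]] := @first_visit x s.
  by exists s; rewrite ?s1 ?lexx.
exists T => //; rewrite T0/= -lee_fin; apply: le_trans H.
by apply: le_ereal_inf_tmp => _ [q [q0 Sq] <-]; rewrite lee_fin Tmin.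
Qed.

Lemma hitting_time_ge0 x : (0 <= hitting_time S x)%E.
Proof. by apply: le_ereal_inf_tmp => _ [q [q0 Sq] <-]; rewrite lee_fin. Qed.

(** What has been explored at time t contains the path to the position at this time, and
    whatever has been explored of the branches hanging off this path. *)
Lemma explored_total_ge t : 0 <= t ->
  depth (S t) + \sum_(w | (w != root) && anc w (arc_of (S t)))
    \sum_(u | sibling w u) branch_sum (explored S ^~ t) u
  <= \sum_(v | v != root) explored S v t.
Proof.
move=> t0; rewrite (sum_decomposition _ (arc_of (S t))) lerD2r depthE.
rewrite -[leLHS]addr0 lerD//.
  by apply: ler_sum => z /andP[z0 _]; apply: le_explored => //; rewrite t0 lexx.
apply: sumr_ge0 => c /childP[c0 _]; apply: sumr_ge0 => z cz.
by case/andP: (@explored_itv _ _ _ speedS z t (anc_root_neq c0 cz) t0).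
Qed.

(** Beyond x nothing can have been explored before the first visit to x, and the arcs
    that lead to x have been explored up to x. *)
Lemma explored_first x T z : 0 <= T -> S T = x -> (forall s, 0 <= s -> S s = x -> T <= s) ->
  z != root -> anc z (arc_of x) || anc (arc_of x) z -> explored S z T = covered x z.
Proof.
move=> T0 ST Tmin z0 zx; apply/eqP; rewrite eq_le; apply/andP; split; last first.
  by rewrite -ST; apply: le_explored => //; rewrite T0 lexx.
have [q /andP[q0 qT] [qE _]] := explored_attained speedS z0 T0.
rewrite -qE leNgt; apply/negP => lt_cov.
have cq : 0 < covered (S q) z by apply: le_lt_trans lt_cov; exact: covered_ge0.
have xz : anc (arc_of x) z.
  have [zax|nzax] := boolP (anc z (arc_of x)); last by case/orP: zx nzax => // ->.
  have [<-|nzx] := eqVneq z (arc_of x); first by rewrite anc_refl.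
  by move: lt_cov; rewrite (covered_full zax)// ltNge covered_le_len.
have [x0|x0] := eqVneq (arc_of x) root.
  have Tq : T = 0.
    apply/eqP; rewrite eq_le T0 andbT Tmin//; rewrite speedS.1.
    by apply: covered_inj => v v0; rewrite covered_origin covered_eq0// x0;
      apply: contra v0 => /anc_of_root ->.
  have qq : q = T by move: q0 qT; rewrite Tq; lra.
  by move: lt_cov; rewrite qq ST ltxx.
have [s /andP[s0 sq] Ss] : visited S q x.
  apply/(visitedP speedS x0 q0); apply: le_trans (_ : covered (S q) (arc_of x) <= _); last first.
    by apply: le_explored => //; rewrite q0 lexx.
  have [E|nE] := eqVneq (arc_of x) z; first by rewrite -covered_arc E ltW.
  rewrite (covered_anc z0 cq)//; by case/andP: (offset_itv x0).
have qE' : q = T by apply/eqP; rewrite eq_le qT (le_trans (Tmin s _ _)).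
by move: lt_cov; rewrite qE' ST ltxx.
Qed.

Lemma explored_total_first x T : 0 <= T -> S T = x ->
  (forall s, 0 <= s -> S s = x -> T <= s) ->
  \sum_(v | v != root) explored S v T =
  depth x + \sum_(w | (w != root) && anc w (arc_of x))
    \sum_(u | sibling w u) branch_sum (explored S ^~ T) u.
Proof.
move=> T0 ST Tmin; rewrite (sum_decomposition _ (arc_of x)); congr (_ + _).
rewrite depthE [X in _ + X]big1 ?addr0.
  by apply: eq_bigr => z /andP[z0 zx]; rewrite (explored_first T0 ST Tmin z0)// zx.
move=> c /childP[c0 cx]; apply: big1 => z cz.
have z0 := anc_root_neq c0 cz.
have xz : anc (arc_of x) z by apply: anc_trans cz; rewrite -cx anc_parent.
rewrite (explored_first T0 ST Tmin z0) ?xz ?orbT// covered_eq0//.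
apply/negP => zx; move: (anc_parent_neq c0); rewrite cx.
by rewrite (parent_connect_anti zx xz) cz.
Qed.

End one_search.

Lemma first_hit S (tau : location Q -> R) x : 0 <= tau x ->
  (forall t, 0 <= t -> visited S t x <-> tau x <= t) -> S (tau x) = x.
Proof.
move=> t0 H; have [s /andP[s0 st] Ss] := (H (tau x) t0).2 (lexx _).
suff -> : tau x = s by [].
by apply/eqP; rewrite eq_le st andbT; apply: (H s s0).1; exists s; rewrite ?s0 ?lexx.
Qed.

(** Let x be the last newly visited point up to time t. From the visit to x on nothing new
    is explored, so without waste every unit of time is spent reducing the depth: the
    trajectory goes from x straight towards the root. Its position is thus determined by x
    and t, and x is determined by the timetable tau. *)
Lemma unique_search S D (tau : location Q -> R) t : unit_speed S -> unit_speed D ->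
  (forall x, 0 <= tau x) ->
  (forall x t, 0 <= t -> visited S t x <-> tau x <= t) ->
  (forall x t, 0 <= t -> visited D t x <-> tau x <= t) ->
  0 <= t -> waste S t = 0 -> waste D t = 0 -> S t = D t.
Proof.
move=> sS sD tau0 hS hD t0 wS wD.
have tipE U v : unit_speed U -> (forall x t, 0 <= t -> visited U t x <-> tau x <= t) ->
    v != root -> 0 < explored U v t -> tau (point v (explored U v t)) <= t.
  move=> sU hU v0 k0; have /andP[_ kl] := explored_itv sU v0 t0.
  apply/hU => //; apply/visitedP; rewrite ?arc_of_point// offset_point ?k0//.
have le_expl U V v : unit_speed U -> unit_speed V ->
    (forall x t, 0 <= t -> visited U t x <-> tau x <= t) ->
    (forall x t, 0 <= t -> visited V t x <-> tau x <= t) ->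
    v != root -> explored U v t <= explored V v t.
  move=> sU sV hU hV v0; have /andP[_ kl] := explored_itv sU v0 t0.
  have [k0|k0] := leP (explored U v t) 0.
    by apply: le_trans k0 _; case/andP: (explored_itv sV v0 t0).
  have /hV := tipE _ _ sU hU v0 k0; move=> /(_ t0) /(visitedP sV).
  by rewrite arc_of_point offset_point ?k0// => /(_ v0 t0).
have explE v : v != root -> explored D v t = explored S v t.
  by move=> v0; apply/eqP; rewrite eq_le !le_expl.
(* if some arc is explored at time t, x is the last visited of the farthest explored
   points of the arcs *)
have [v1 /andP[v10 k1]|none] := pickP [pred v | (v != root) && (0 < explored S v t)]; last first.
  have k0 v : v != root -> explored S v t = 0.
    move=> v0; have /andP[] := explored_itv sS v0 t0; have := none v; rewrite /= v0/=.
    by move/negbT; rewrite -leNgt => ? ? _; apply/eqP; rewrite eq_le; apply/andP.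
  apply: covered_inj => v v0.
  have tt : 0 <= t <= t by rewrite t0 lexx.
  have := le_explored sS v0 tt; have := le_explored sD v0 tt; rewrite explE// k0//.
  by have := covered_ge0 (S t) v; have := covered_ge0 (D t) v; lra.
pose P := [pred v | (v != root) && (0 < explored S v t)].
have Pv1 : P v1 by rewrite /= v10.
case: (@arg_maxP _ _ _ v1 P (fun v => tau (point v (explored S v t))) Pv1) => v /andP[v0 kv] vmax.
pose x := point v (explored S v t); have xt : tau x <= t by exact: tipE.
have key U : unit_speed U -> (forall x t, 0 <= t -> visited U t x <-> tau x <= t) ->
    (forall v, v != root -> explored U v t = explored S v t) -> waste U t = 0 ->
    precedes (U t) x /\ depth (U t) = depth x - (t - tau x).
  move=> sU hU eU wU.
  have axt : 0 <= tau x <= t by rewrite tau0.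
  have Ux : U (tau x) = x by apply: (first_hit (tau0 x)) => s; exact: hU.
  have waU : waste U (tau x) = 0.
    by apply/eqP; rewrite eq_le -{1}wU waste_mono//= waste_ge0.
  have ea z : z != root -> explored U z (tau x) = explored U z t.
    move=> z0; apply/eqP; rewrite eq_le explored_mono//=.
    have /andP[_ kl] := explored_itv sU z0 t0.
    have [k0|k0] := leP (explored U z t) 0.
      by apply: le_trans k0 _; case/andP: (explored_itv sU z0 (tau0 x)).
    have : visited U (tau x) (point z (explored U z t)).
      by apply/hU => //; rewrite eU//; apply: vmax; rewrite /P/= z0 -eU.
    by move/(visitedP sU); rewrite arc_of_point offset_point ?k0//; apply.
  have dU : depth (U t) = depth x - (t - tau x).
    move: wU waU; rewrite /waste Ux (eq_bigr (fun z => explored U z t) ea); lra.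
  split=> //; apply: precedes_of_depth; rewrite dU -{1}Ux.
  by apply: le_trans (speed sU axt) _; lra.
have [pS dS] := key S sS hS (fun v _ => erefl) wS.
have [pD dD] := key D sD hD explE wD.
by apply: precedes_depth_inj pS pD _; rewrite dS dD.
Qed.

End first_visits.

(** * The timetable of a depth-first search *)

Local Notation L := (branch_sum (@len _ _)).

Section tour_time.
Context {R : realType} {Q : tree_network R}.
Implicit Types (u v w z c : node Q) (x y : location Q) (S D : R -> location Q).

Variable pos : node Q -> nat.

(** The length of the branches visited before the branch of w, when the children of each
    node are visited in increasing order of pos. *)
Definition delay w : R := \sum_(u | sibling w u && (pos u < pos w)%N) L u.

(** The time at which the depth-first search that visits children in increasing order of
    pos reaches x: the branches that it completes before x are traversed twice. *)
Definition tour_time x : R :=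
  depth x + 2 * \sum_(w | (w != root) && anc w (arc_of x)) delay w.

Lemma branch_sum_len_ge0 u : 0 <= L u.
Proof. by apply: sumr_ge0 => z _; exact: len_ge0. Qed.

Lemma delay_ge0 w : 0 <= delay w.
Proof. by apply: sumr_ge0 => u _; exact: branch_sum_len_ge0. Qed.

Lemma tour_time_ge0 x : 0 <= tour_time x.
Proof.
apply: addr_ge0; first by apply: sumr_ge0 => v _; exact: covered_ge0.
by apply: mulr_ge0 => //; apply: sumr_ge0 => w _; exact: delay_ge0.
Qed.

Lemma arc_of_root x : arc_of x = root -> x = origin Q.
Proof. by move=> x0; rewrite -[LHS]point_arc -[RHS]point_arc x0 !offset_root. Qed.

Lemma depth_arc x : arc_of x != root ->
  depth x = depth (at_node (parent (arc_of x))) + offset x.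
Proof.
move=> x0; rewrite !depthE sum_anc_step// covered_arc addrC; congr (_ + _).
rewrite arc_of_node; apply: eq_bigr => z /andP[z0 zx].
rewrite (covered_node _ z0) zx covered_full//; first exact: anc_trans zx (anc_parent _).
by apply: contraTneq zx => ->; exact: anc_parent_neq.
Qed.

Lemma tour_time_arc x : arc_of x != root ->
  tour_time x = tour_time (at_node (parent (arc_of x))) + 2 * delay (arc_of x) + offset x.
Proof.
by move=> x0; rewrite /tour_time depth_arc// sum_anc_step// arc_of_node; ring.
Qed.

Lemma tour_time_node v : v != root ->
  tour_time (at_node v) = tour_time (at_node (parent v)) + 2 * delay v + len v.
Proof. by move=> v0; rewrite tour_time_arc. Qed.

Lemma tour_time_origin : tour_time (origin Q) = 0.
Proof. by rewrite /tour_time depth_origin sum_anc_root mulr0 addr0. Qed.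

Lemma tour_time_anc v z : anc v z -> tour_time (at_node v) <= tour_time (at_node z).
Proof.
elim/(@tree_ind_down _ Q): z => [/anc_of_root ->//|z z0 IH].
rewrite ancE => /orP[/eqP ->//|/andP[_ /IH/le_trans]]; apply.
by rewrite (tour_time_node z0); have := delay_ge0 z; have := len_ge0 z; lra.
Qed.

Lemma delay_sibling u w : w != root -> sibling w u -> (pos u < pos w)%N ->
  delay u + L u <= delay w.
Proof.
move=> w0 wu uw; have /and3P[u0 /eqP puw _] := wu.
rewrite /delay [leRHS](bigD1 u)/= ?wu//= [leLHS]addrC lerD2l.
rewrite big_mkcond [leRHS]big_mkcond/=; apply: ler_sum => z _.
case: ifPn => [/andP[/and3P[z0 /eqP pz zu] pzu]|_]; last first.
  by case: ifP => // _; exact: branch_sum_len_ge0.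
rewrite ifT ?lexx// /sibling/= z0 pz puw eqxx (ltn_trans pzu uw) zu !andbT.
by apply: contraTneq (ltn_trans pzu uw) => ->; rewrite ltnn.
Qed.

Lemma delay_children v : v != root -> delay v + L v <= \sum_(c | child (parent v) c) L c.
Proof.
move=> v0; rewrite /delay [leRHS](bigD1 v)/=; last exact/childP.
rewrite [leLHS]addrC lerD2l big_mkcond [leRHS]big_mkcond; apply: ler_sum => u _.
case: ifPn => [/andP[/and3P[u0 pu uv] _]|_]; first by rewrite /child/= u0 pu uv.
by case: ifP => // _; exact: branch_sum_len_ge0.
Qed.

(** Twice the sum over the children of z is the time to be spent beyond z, and the right-hand
    side is the time at which the branch of u is completed, except for the last return along
    the arc u. *)
Lemma tour_time_branch u z : u != root -> anc u z ->
  tour_time (at_node z) + 2 * \sum_(c | child z c) L c <=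
  tour_time (at_node (parent u)) + 2 * delay u - len u + 2 * L u.
Proof.
move=> u0; elim/(@tree_ind_down _ Q): z => [/anc_of_root u00|z z0 IH].
  by rewrite u00 eqxx in u0.
rewrite ancE => /orP[/eqP <-|/andP[_ /IH]].
  by rewrite (tour_time_node u0) (branch_sum_rec _ u); lra.
apply: le_trans; rewrite (tour_time_node z0).
by have := delay_children z0; rewrite (branch_sum_rec _ z); have := len_ge0 z; lra.
Qed.

Lemma tour_time_order u w z x : w != root -> sibling w u -> (pos u < pos w)%N ->
  anc u z -> anc w (arc_of x) -> tour_time (at_node z) <= tour_time x.
Proof.
move=> w0 wu uw uz wx; have /and3P[u0 /eqP puw _] := wu.
have x0 := anc_root_neq w0 wx.
apply: le_trans (_ : tour_time (at_node (parent w)) + 2 * delay w <= _).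
  have := tour_time_branch u0 uz; have := delay_sibling w0 wu uw; rewrite puw.
  have : 0 <= \sum_(c | child z c) L c by apply: sumr_ge0 => c _; exact: branch_sum_len_ge0.
  by have := len_gt0 u0; lra.
rewrite (tour_time_arc x0); have /andP[off _] := offset_itv x0.
move: wx; rewrite ancE => /orP[/eqP <-|/andP[_ /tour_time_anc]]; first by lra.
by rewrite (tour_time_node w0); have := len_ge0 w; have := delay_ge0 (arc_of x); lra.
Qed.

Lemma tour_time_max : exists z, forall x, tour_time x <= tour_time (at_node z).
Proof.
pose z := [arg max_(z > root) tour_time (at_node z)]%O; exists z => x.
apply: le_trans (_ : tour_time (at_node (arc_of x)) <= _).
  have [/arc_of_root ->|x0] := eqVneq (arc_of x) root.
    exact: lexx.
  by rewrite (tour_time_arc x0) (tour_time_node x0); case/andP: (offset_itv x0); lra.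
by rewrite /z; case: arg_maxP => // i _ H; exact: H.
Qed.

Section punctual.
Variable D : R -> location Q.
Hypothesis speedD : unit_speed D.
Hypothesis punctualD : forall x, D (tour_time x) = x.

Lemma explored_tour_node z t : z != root -> tour_time (at_node z) <= t ->
  explored D z t = len z.
Proof.
move=> z0 zt; have zt' : 0 <= tour_time (at_node z) <= t by rewrite tour_time_ge0.
have t0 : 0 <= t by apply: le_trans zt; exact: tour_time_ge0.
apply/eqP; rewrite eq_le; have /andP[_ ->] := explored_itv speedD z0 t0.
by have := le_explored speedD z0 zt'; rewrite punctualD covered_node// anc_refl.
Qed.

(** The point x is reached after all the branches scheduled before it, so the explored
    length is at least half of tour_time x + depth x. As waste is nonnegative it cannot be
    more, and this leaves no room for a part of the arc of x beyond x. *)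
Lemma punctual_explored x : arc_of x != root ->
  explored D (arc_of x) (tour_time x) = offset x /\ waste D (tour_time x) = 0.
Proof.
set v := arc_of x => x0; set t := tour_time x.
have t0 : 0 <= t by exact: tour_time_ge0.
have tt : 0 <= t <= t by rewrite t0 lexx.
have e0 z : z != root -> 0 <= explored D z t.
  by move=> z0; case/andP: (explored_itv speedD z0 t0).
have b0 u : u != root -> 0 <= branch_sum (explored D ^~ t) u.
  by move=> u0; apply: sumr_ge0 => z uz; apply: e0; exact: anc_root_neq uz.
have off : offset x <= explored D v t.
  by rewrite -covered_arc -{1}(punctualD x); exact: le_explored.
have lower : depth x + (explored D v t - offset x) +
    \sum_(w | (w != root) && anc w v) delay w <= \sum_(z | z != root) explored D z t.
  have H1 : depth x + (explored D v t - offset x) <=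
      \sum_(z | (z != root) && anc z v) explored D z t.
    rewrite depthE -/v (bigD1 v)/= ?x0 ?anc_refl// [leRHS](bigD1 v)/= ?x0 ?anc_refl//.
    have -> : covered x v = offset x by exact: covered_arc.
    suff : \sum_(z | (z != root) && anc z v && (z != v)) covered x z <=
        \sum_(z | (z != root) && anc z v && (z != v)) explored D z t by lra.
    apply: ler_sum => z /andP[/andP[z0 _] _].
    by rewrite -{1}(punctualD x); exact: le_explored.
  have H2 : 0 <= \sum_(c | child v c) branch_sum (explored D ^~ t) c.
    by apply: sumr_ge0 => c /childP[c0 _]; exact: b0.
  have H3 : \sum_(w | (w != root) && anc w v) delay w <= \sum_(w | (w != root) && anc w v)
      \sum_(u | sibling w u) branch_sum (explored D ^~ t) u.
    apply: ler_sum => w /andP[w0 wv]; rewrite /delay big_mkcondr/=.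
    apply: ler_sum => u wu; have /and3P[u0 _ _] := wu.
    case: ifPn => [uw|_]; last exact: b0.
    apply: ler_sum => z uz; rewrite explored_tour_node//; first exact: anc_root_neq uz.
    exact: tour_time_order uz wv.
  by rewrite (sum_decomposition _ v); lra.
have := waste_ge0 speedD t0; rewrite /waste punctualD.
have tE : t = depth x + 2 * \sum_(w | (w != root) && anc w v) delay w by [].
by rewrite {1 3}tE; split; lra.
Qed.

(** No point is visited ahead of the timetable: otherwise a part of its arc would already
    be explored at the scheduled time of a point situated slightly before it. *)
Lemma punctual_visited x t : 0 <= t -> visited D t x <-> tour_time x <= t.
Proof.
move=> t0; split=> [|xt]; last first.
  by exists (tour_time x); rewrite ?punctualD// tour_time_ge0.
have [/arc_of_root -> _|x0 /(visitedP speedD x0 t0) xe] := eqVneq (arc_of x) root.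
  by rewrite tour_time_origin.
rewrite leNgt; apply/negP => tx; have /andP[off0 offl] := offset_itv x0.
(* the lower bound offset x / 2 keeps s positive, so that it denotes a point of the arc *)
pose s := Num.max (offset x / 2) (offset x - (tour_time x - t)).
have sx : 0 < s < offset x by rewrite /s; case: (leP (offset x / 2)) => ?; lra.
have sl : 0 < s <= len (arc_of x) by lra.
pose y := point (arc_of x) s.
have yx : arc_of y = arc_of x by rewrite arc_of_point.
have offy : offset y = s by rewrite offset_point.
have y0 : arc_of y != root by rewrite yx.
have ty : tour_time y = tour_time x - (offset x - s).
  by rewrite (tour_time_arc y0) (tour_time_arc x0) yx offy; ring.
have le_ty : t <= tour_time y.
  by rewrite ty /s; case: (leP (offset x / 2)) => ?; lra.
have [E _] := punctual_explored y0.
have : explored D (arc_of x) t <= explored D (arc_of x) (tour_time y).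
  by apply: explored_mono => //; rewrite t0.
by rewrite -{2}yx E offy; lra.
Qed.

Lemma punctual_waste t : 0 <= t -> (exists x, t <= tour_time x) -> waste D t = 0.
Proof.
move=> t0 [x tx]; apply/eqP; rewrite eq_le waste_ge0// andbT.
apply: le_trans (waste_mono speedD (_ : 0 <= t <= tour_time x)) _; first by rewrite t0.
have [/arc_of_root ->|/punctual_explored[_ ->]//] := eqVneq (arc_of x) root.
by rewrite tour_time_origin waste0.
Qed.

Lemma punctual_until_covered t : until_covered D t -> exists x, t <= tour_time x.
Proof.
move=> ut; have [z zmax] := tour_time_max; exists (at_node z); rewrite leNgt.
apply/negP => zt; apply: (ut (tour_time (at_node z))); first by rewrite tour_time_ge0.
by move=> x; exists (tour_time x) => //; rewrite tour_time_ge0 zmax.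
Qed.

End punctual.

Lemma punctual_unique S D : unit_speed S -> unit_speed D ->
  (forall x, S (tour_time x) = x) -> (forall x, D (tour_time x) = x) ->
  forall t, 0 <= t -> until_covered S t -> S t = D t.
Proof.
move=> sS sD pS pD t t0 /(punctual_until_covered pS) tx.
apply: (unique_search sS sD tour_time_ge0 _ _ t0).
- by move=> x s; exact: punctual_visited.
- by move=> x s; exact: punctual_visited.
- exact: punctual_waste.
- exact: punctual_waste.
Qed.

End tour_time.

(** * Normality of trajectories that lose no time *)

Section normality.
Context {R : realType} {Q : tree_network R}.
Implicit Types (v z : node Q) (x y : location Q) (S D : R -> location Q).

Lemma geodesic_goes_directly D t1 t2 : 0 <= t1 ->
  (forall s t, t1 <= s -> s < t -> t <= t2 -> mdist (D s) (D t) <= t - s) ->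
  t2 - t1 <= mdist (D t1) (D t2) -> goes_directly D t1 t2.
Proof.
move=> t10 sD + s /andP[s0 st].
have H (a b : R) : t1 <= a -> a <= b -> b <= t2 -> mdist (D a) (D b) <= b - a.
  move=> ta; rewrite le_eqVlt => /predU1P[->|ab bt]; last exact: sD.
  by rewrite subrr mdistxx.
have H1 : mdist (D t1) (D (t1 + s)) <= (t1 + s) - t1 by apply: H; lra.
have H2 : mdist (D (t1 + s)) (D t2) <= t2 - (t1 + s) by apply: H; lra.
have H3 : mdist (D t1) (D t2) <= t2 - t1 by apply: H; lra.
have H4 : mdist (D t1) (D t2) <= mdist (D t1) (D (t1 + s)) + mdist (D (t1 + s)) (D t2).
  exact: path_length_triangle.
by move=> dD; rewrite /path_between/=; split; lra.
Qed.

(** If the trajectory covers exactly the path from D t1 to D t2, then what it discovers in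
    the meantime lies on the part of this path that descends to D t2. Without waste this
    limits the time spent to the length of the path. *)
Lemma wasteless_normal D : unit_speed D ->
  (forall t, 0 <= t -> until_covered D t -> waste D t = 0) -> normal_search D.
Proof.
move=> sD wD t1 t2 t10 t12 ut2 imE.
have t20 : 0 <= t2 by lra.
have w2 := wD _ t20 ut2.
have w1 : waste D t1 = 0.
  apply: wD => // s /andP[s0 st]; apply: ut2; lra.
have t12' : 0 <= t1 <= t2 by lra.
apply: geodesic_goes_directly => //.
  by move=> s t ts st _; apply: sD.2 => //; lra.
have := waste_sub D t1 t2; rewrite w1 w2 subrr => /esym/eqP; rewrite subr_eq0 => /eqP ->.
rewrite mdistE; apply: ler_sum => v v0.
have [q /andP[q0 qt2] [qE _]] := explored_attained sD v0 t20.
have e1 : covered (D t1) v <= explored D v t1 by apply: le_explored; rewrite ?t10 ?lexx.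
have e12 := explored_mono sD v0 t12'.
have := ler_norm (covered (D t1) v - covered (D t2) v).
have := ler_norm (covered (D t2) v - covered (D t1) v).
rewrite (distrC (covered (D t2) v)).
have [qt1|t1q] := leP q t1.
  have : explored D v t2 <= explored D v t1 by rewrite -qE; apply: le_explored; rewrite ?q0.
  by lra.
have : path_between (D t1) (D t2) (D q).
  by rewrite -imE; exists q => //=; rewrite in_itv/= qt2 ltW.
rewrite /path_between/= => /eqP; rewrite eq_le => /andP[/betweenP/(_ v v0) + _].
rewrite qE.
have : `|covered (D t1) v - explored D v t2| = explored D v t2 - covered (D t1) v.
  by rewrite distrC ger0_norm// subr_ge0; lra.
have := ler_norm (covered (D t2) v - explored D v t2).
have := ler_norm (explored D v t2 - covered (D t2) v).
rewrite (distrC (covered (D t2) v)); lra.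
Qed.

End normality.

(** * Depth-first walks *)

Section walks.
Context {R : realType} {Q : tree_network R}.
Implicit Types (u v z c : node Q) (x y : location Q) (D : R -> location Q).
Implicit Types (w s : seq (node Q)) (e : node Q * node Q) (st : seq (node Q * node Q)).

Definition steps_from v w := zip (v :: w) w.

Lemma steps_from_cat v w1 w2 :
  steps_from v (w1 ++ w2) = steps_from v w1 ++ steps_from (last v w1) w2.
Proof. by elim: w1 v => //= u w IH v; rewrite /steps_from/= -/(steps_from _ _) IH. Qed.

Lemma size_steps_from v w : size (steps_from v w) = size w.
Proof. by rewrite size_zip/=; exact/minn_idPr. Qed.

Definition duration st : R := \sum_(e <- st) mdist (at_node e.1) (at_node e.2).

Lemma duration_cat st1 st2 : duration (st1 ++ st2) = duration st1 + duration st2.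
Proof. by rewrite /duration big_cat. Qed.

Lemma duration_cons e st : duration (e :: st) = mdist (at_node e.1) (at_node e.2) + duration st.
Proof. by rewrite /duration big_cons. Qed.

Lemma duration_nil : duration [::] = 0. Proof. by rewrite /duration big_nil. Qed.

(** Unlike point, this is continuous at 0. *)
Definition on_arc v (s : R) : location Q := if s == 0 then at_node (parent v) else point v s.

Lemma covered_on_arc v (s : R) z : v != root -> 0 <= s <= len v -> z != root ->
  covered (on_arc v s) z = if z == v then s else covered (at_node (parent v)) z.
Proof.
move=> v0 /andP[s0 sl] z0; rewrite /on_arc; have [->|sn0] := eqVneq s 0.
  by case: eqVneq => // ->; rewrite covered_node// (negbTE (anc_parent_neq v0)).
have sv : 0 < s <= len v by rewrite lt_neqAle eq_sym sn0 s0.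
case: eqVneq => [->|zv]; first exact: covered_point.
rewrite covered_node// /covered arc_of_point (negbTE zv) ancE v0 /=.
by rewrite (negbTE zv).
Qed.

Lemma mdist_on_arc v (s t : R) : v != root -> 0 <= s <= len v -> 0 <= t <= len v ->
  mdist (on_arc v s) (on_arc v t) = `|s - t|.
Proof.
move=> v0 sv tv; rewrite mdistE (bigD1 v)//= !covered_on_arc// eqxx big1 ?addr0//.
by move=> z /andP[z0 /negbTE zv]; rewrite !covered_on_arc// zv subrr normr0.
Qed.

Lemma on_arc0 v : on_arc v 0 = at_node (parent v).
Proof. by rewrite /on_arc eqxx. Qed.

Lemma on_arc_len v : v != root -> on_arc v (len v) = at_node v.
Proof. by move=> v0; rewrite /on_arc gt_eqF ?len_gt0// point_len. Qed.

Lemma mdist_arc v : v != root -> mdist (at_node (parent v)) (at_node v) = len v.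
Proof.
move=> v0; rewrite -on_arc0 -on_arc_len// mdist_on_arc ?lexx ?len_ge0//.
by rewrite sub0r normrN ger0_norm ?len_ge0.
Qed.

Lemma mdist_nodeC u v : mdist (at_node u) (at_node v) = mdist (at_node v) (at_node u).
Proof. exact: path_length_sym. Qed.

Lemma adjacent_segment u v : adjacent u v -> exists g : R -> location Q,
  [/\ g 0 = at_node u, g (mdist (at_node u) (at_node v)) = at_node v
    & forall s t : R, 0 <= s -> s < t -> t <= mdist (at_node u) (at_node v) ->
        mdist (g s) (g t) <= t - s].
Proof.
case/orP => /andP[c0 /eqP <-].
  exists (on_arc v); rewrite mdist_arc// on_arc0 on_arc_len//; split=> // s t s0 st tl.
  rewrite mdist_on_arc//; [|lra|lra].
  by rewrite distrC ger0_norm ?subr_ge0// ltW.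
rewrite mdist_nodeC mdist_arc//; exists (fun s : R => on_arc u (len u - s)).
rewrite subr0 subrr on_arc0 on_arc_len//; split=> // s t s0 st tl.
rewrite mdist_on_arc//; [|lra|lra].
by rewrite opprB addrC addrA subrK ger0_norm ?subr_ge0// ltW.
Qed.

(** Any trajectory that connects the nodes of a walk at unit speed will do: between two
    adjacent nodes it is forced to follow the arc. *)
Lemma interpolation u w : path adjacent u w -> exists D : R -> location Q,
  [/\ D 0 = at_node u,
      forall s t : R, 0 <= s -> s < t -> mdist (D s) (D t) <= t - s
    & forall i, (i <= size w)%N ->
        D (duration (take i (steps_from u w))) = at_node (nth root (u :: w) i)].
Proof.
elim: w u => [u _|v w IH u /= /andP[uv vw]].
  exists (fun=> at_node u); split=> // [s t s0 st|i].
    by rewrite mdistxx subr_ge0 ltW.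
  by rewrite leqn0 => /eqP ->.
have [D [D0 Dlip DE]] := IH _ vw; have [g [g0 gl glip]] := adjacent_segment uv.
set l := mdist (at_node u) (at_node v) in gl glip.
have l0 : 0 <= l by exact: mdist_ge0.
exists (fun t => if t <= l then g t else D (t - l)); split=> [|s t s0 st|[|i] /= iw].
- by rewrite l0.
- have [tl|lt] := leP t l; first by rewrite (le_trans (ltW st))// glip.
  have Dl r : l < r -> mdist (at_node v) (D (r - l)) <= r - l.
    by move=> lr; rewrite -D0 -[leRHS]subr0 Dlip// subr_gt0.
  have [sl|ls] := leP s l; last first.
    by apply: le_trans (Dlip _ _ _ _) _; lra.
  apply: le_trans (_ : mdist (g s) (at_node v) + mdist (at_node v) (D (t - l)) <= _).
    exact: path_length_triangle.
  have : mdist (g s) (at_node v) <= l - s.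
    have [->|sl'] := eqVneq s l; first by rewrite gl mdistxx subrr.
    by rewrite -gl; apply: glip => //; rewrite lt_neqAle sl'.
  by have := Dl _ lt; lra.
- by rewrite duration_nil l0.
rewrite /steps_from/= -/(steps_from v w) duration_cons/= -/l -DE//.
have d0 : 0 <= duration (take i (steps_from v w)).
  by apply: sumr_ge0 => e _; exact: mdist_ge0.
case: leP => [dl|_]; last by rewrite addrAC subrr add0r.
have -> : duration (take i (steps_from v w)) = 0 by lra.
by rewrite addr0 gl D0.
Qed.

Section tour.
Variable pos : node Q -> nat.
Hypothesis pos_inj : injective pos.

Local Notation tau := (tour_time pos).
Local Notation start v := (tau (at_node (parent v)) + 2 * delay pos v).

(** A walk from v back to v through the branches of the nodes in s (children of v). The
    depth-first condition is stated by comparing first occurrences, a form that is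
    preserved by concatenation. The last clause says that each arc is entered on
    schedule. *)
Definition tours v s w : Prop :=
  [/\ path adjacent v w, last v w = v
    & let st := steps_from v w in
      [/\ forall u, u != root -> count_mem (parent u, u) st = has (fun c => anc c u) s /\
                                 count_mem (u, parent u) st = has (fun c => anc c u) s,
          forall u c, u != root -> child u c -> (u, parent u) \in st ->
            (index (parent c, c) st < index (u, parent u) st)%N,
          duration st = 2 * \sum_(c <- s) L c
        & forall u, has (fun c => anc c u) s -> exists st1 st2,
            st = st1 ++ (parent u, u) :: st2 /\ tau (at_node v) + duration st1 = start u]].

(** This holds for the initial segments of the sorted list of the children of v, over which
    the construction of a tour proceeds. *)
Definition ordered v s : Prop :=
  [/\ uniq s, forall c, c \in s -> child v c
    & forall s1 c s2, s = s1 ++ c :: s2 -> delay pos c = \sum_(u <- s1) L u].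

(** Appends to a tour the arc to c, a tour of the branches beyond c, and the arc back. *)
Lemma tours_rcons v s c w wc sc : ordered v (rcons s c) -> tours v s w ->
  (forall u, (u \in sc) = child c u) -> uniq sc -> tours c sc wc ->
  tours v (rcons s c) (w ++ c :: rcons wc v).
Proof.
move=> [us sv sdelay] [pw lw [cw iw dw aw]] sc_child usc [pc lc [cc ic dc ac]].
have /childP[c0 cv] : child v c by apply: sv; rewrite mem_rcons inE eqxx.
have stE : steps_from v (w ++ c :: rcons wc v) =
    steps_from v w ++ (v, c) :: rcons (steps_from c wc) (c, v).
  rewrite steps_from_cat lw; congr (_ ++ _).
  by rewrite /steps_from/= -/(steps_from c _) -cats1 steps_from_cat lc /= cats1.
have has_sc u : has (fun c' => anc c' u) sc = anc c u && (u != c).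
  apply/hasP/andP => [[c' + c'u]|[cu uc]].
    rewrite sc_child => /childP[c'0 c'c]; split.
      by apply: anc_trans c'u; rewrite -c'c anc_parent.
    by apply: contraTneq c'u => ->; rewrite -c'c; exact: anc_parent_neq.
  have [c' cc' c'u] := anc_child cu uc.
  by exists c' => //; rewrite sc_child.
have no_up u : u != root -> ((v, c) == (u, parent u)) = false.
  move=> u0; apply/eqP => -[vu cu]; have := anc_parent_neq c0.
  by rewrite cv vu cu anc_parent.
have no_down u : u != root -> ((c, v) == (parent u, u)) = false.
  by move=> u0; rewrite xpair_eqE; apply/negP => /andP[/eqP cu /eqP vu];
    have := anc_parent_neq c0; rewrite cv vu cu anc_parent.
have disj u : has (fun c' => anc c' u) s -> anc c u = false.
  case/hasP => c' c's c'u; have /childP[c'0 c'v] : child v c'.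
    by apply: sv; rewrite mem_rcons inE c's orbT.
  apply/negbTE/(@siblings_disjoint _ _ c' c) => //; first by rewrite cv.
  by apply: contraTneq us => <-; rewrite rcons_uniq c's.
split.
- rewrite cat_path pw lw /= rcons_path pc lc /= /adjacent c0 cv eqxx.
  by rewrite orbT.
- by rewrite last_cat /= last_rcons.
rewrite /= stE; split.
- move=> u u0; rewrite !count_cat /= -!cats1 !count_cat /= !addn0.
  have [-> ->] := cw u u0; have [-> ->] := cc u u0.
  rewrite no_up// no_down// cats1 has_rcons has_sc !xpair_eqE.
  have -> : (v == parent u) && (c == u) = (c == u).
    by case: (eqVneq c u) => [<-|_]; rewrite ?andbF// cv eqxx.
  have -> : (c == u) && (v == parent u) = (c == u).
    by case: (eqVneq c u) => [<-|_]; rewrite ?andbF// cv eqxx.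
  have := disj u; case: has => [/(_ isT) cu|_].
    rewrite cu; have -> : (c == u) = false by apply: contraFF cu => /eqP ->; exact: anc_refl.
    by [].
  by rewrite eq_sym; case: (eqVneq u c) => [->|_]; rewrite ?anc_refl// ?andbT ?andbF;
    case: (anc c u).
- have before A X e f : (f \in A -> (index e A < index f A)%N) ->
      (f \notin A -> f \in X -> (index e X < index f X)%N) ->
      f \in A ++ X -> (index e (A ++ X) < index f (A ++ X))%N.
    move=> HA HX; rewrite mem_cat !index_cat; have [fA _|fA /= fX] := boolP (f \in A).
      by rewrite ifT ?HA// -index_mem (ltn_trans (HA fA))// index_mem.
    case: ifP => [eA|_]; last by rewrite ltn_add2l HX.
    by rewrite ltn_addr// index_mem.
  move=> u c' u0 uc'; apply: (before (steps_from v w)); first exact: iw.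
  move=> _; rewrite in_cons [_ == (v, c)]eq_sym no_up//= => uX.
  rewrite eq_sym no_up//; case: ifP => // _; rewrite ltnS.
  move: uX; rewrite -cats1 mem_cat inE => uX.
  have [uB|uB] := boolP ((u, parent u) \in steps_from c wc).
    by apply: (before (steps_from c wc)) => //; [exact: ic | rewrite uB | rewrite mem_cat uB].
  move: uX; rewrite (negbTE uB)/= => /eqP[uc pu].
  have [c'0 c'u] := childP _ _ uc'.
  have c'B : (parent c', c') \in steps_from c wc.
    rewrite -has_pred1 has_count (cc c' c'0).1 has_sc -{1}uc -c'u anc_parent/= -uc -c'u.
    by rewrite lt0b; apply: contra (anc_parent_neq c'0) => /eqP <-; exact: anc_refl.
  rewrite !index_cat c'B (negbTE uB); apply: leq_trans (leq_addr _ _).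
  by rewrite index_mem.
- rewrite duration_cat dw duration_cons /= -cats1 duration_cat dc duration_cons.
  rewrite duration_nil /= (mdist_nodeC c) -cv mdist_arc//.
  rewrite -cats1 big_cat big_seq1 (branch_sum_rec _ c) /=.
  have -> : \sum_(c1 <- sc) L c1 = \sum_(c1 | child c c1) L c1.
    by rewrite big_uniq//; apply: eq_bigl => u; rewrite sc_child.
  by ring.
- move=> u; rewrite has_rcons => /orP[]; last first.
    move/aw => [st1 [st2 [-> E]]]; exists st1, (st2 ++ (v, c) :: rcons (steps_from c wc) (c, v)).
    by rewrite -catA.
  have sE : tau (at_node v) + duration (steps_from v w) = start c.
    by rewrite dw (sdelay s c [::]) ?cats1// cv.
  have [<- _|nuc cu] := eqVneq c u.
    by exists (steps_from v w), (rcons (steps_from c wc) (c, v)); rewrite -sE cv.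
  have /ac[st1 [st2 [stcE E]]] : has (fun c' => anc c' u) sc by rewrite has_sc cu eq_sym.
  exists (steps_from v w ++ (v, c) :: st1), (rcons st2 (c, v)).
  rewrite stcE rcons_cat -catA; split=> //.
  rewrite duration_cat duration_cons -E (tour_time_node _ c0)/=.
  by move: sE; rewrite -cv mdist_arc//; lra.
Qed.

Lemma tours_nil v : tours v [::] [::].
Proof. by split=> //; split=> //; rewrite duration_nil big_nil mulr0. Qed.

Lemma tours_ordered v s : ordered v s ->
  (forall c, child v c -> exists sc wc,
    [/\ forall u, (u \in sc) = child c u, uniq sc & tours c sc wc]) ->
  exists w, tours v s w.
Proof.
elim/last_ind: s => [_ _|s c IH os tc]; first by exists [::]; exact: tours_nil.
have [us sv sd] := os.
have [w tw] : exists w, tours v s w.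
  apply: IH tc; split.
  - by move: us; rewrite rcons_uniq => /andP[].
  - by move=> c' c's; apply: sv; rewrite mem_rcons inE c's orbT.
  - by move=> s1 c' s2 sE; apply: (sd s1 c' (rcons s2 c)); rewrite sE rcons_cat.
have cv : child v c by apply: sv; rewrite mem_rcons inE eqxx.
have [sc [wc [mem_sc usc twc]]] := tc c cv.
by exists (w ++ c :: rcons wc v); exact: tours_rcons os tw mem_sc usc twc.
Qed.

Definition children v : seq (node Q) := sort (fun a b => pos a <= pos b)%N (enum (child v)).

Lemma mem_children v u : (u \in children v) = child v u.
Proof. by rewrite mem_sort mem_enum. Qed.

Lemma children_uniq v : uniq (children v).
Proof. by rewrite sort_uniq enum_uniq. Qed.

Lemma children_ordered v : ordered v (children v).
Proof.
split; [exact: children_uniq|by move=> c; rewrite mem_children|].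
move=> s1 c s2 sE; have := children_uniq v; rewrite sE cat_uniq => /and3P[us1 dis _].
have : sorted (fun a b => pos a <= pos b)%N (children v).
  by apply: sort_sorted => a b; exact: leq_total.
rewrite sorted_pairwise; last by move=> a b d; exact: leq_trans.
rewrite sE pairwise_cat /= => /and3P[/allrelP lt1 _ /andP[/allP lt2 _]].
have /childP[c0 cv] : child v c by rewrite -mem_children sE mem_cat inE eqxx orbT.
rewrite big_uniq//; apply: eq_bigl => u; apply/andP/idP.
  move=> [/and3P[u0 /eqP uc nuc] pu].
  have : u \in children v by rewrite mem_children; apply/childP; rewrite uc.
  rewrite sE mem_cat inE (negbTE nuc)/= => /orP[//|/lt2].
  by rewrite leqNgt pu.
move=> us; have nuc : u != c.
  by apply: contraNneq dis => <-; apply/hasP; exists u => //; rewrite inE eqxx.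
have /childP[u0 uv] : child v u by rewrite -mem_children sE mem_cat us.
rewrite /sibling/= u0 uv cv eqxx nuc; split=> //.
rewrite ltn_neqAle lt1// ?inE ?eqxx// andbT.
by apply: contra nuc => /eqP/pos_inj ->.
Qed.

Lemma tours_exist v : exists w, tours v (children v) w.
Proof.
elim/(@tree_ind_up _ Q): v => v IH; apply: tours_ordered (children_ordered v) _ => c cv.
have [w tw] := IH c cv; exists (children c), w; split=> //; last exact: children_uniq.
exact: mem_children.
Qed.

Lemma duration_arrival w i : (i <= size w)%N ->
  duration (take i (steps_from root w)) = arrival w i.
Proof.
move=> iw; rewrite /duration /arrival (big_nth (root, root)) size_take size_steps_from.
have -> : (if (i < size w)%N then i else size w) = i by case: ltnP => // ?; lia.
rewrite big_mkord; apply: eq_bigr => j _; have jw := leq_trans (ltn_ord j) iw.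
rewrite nth_take// /steps_from nth_zip_cond size_zip /= (minn_idPr _)//.
by rewrite jw.
Qed.

(** On each arc the trajectory is punctual at both ends, hence at every point. *)
Lemma tour_search : exists D,
  [/\ depth_first D, unit_speed D & forall x, D (tau x) = x].
Proof.
have [w [pw lw [cw iw dw aw]]] := tours_exist root.
have [D [D0 Dlip DE]] := interpolation pw.
have anc_has u : u != root -> has (fun c => anc c u) (children root).
  move=> u0; have [c cr cu] := anc_child (anc_root u) u0.
  by apply/hasP; exists c; rewrite ?mem_children.
have stepsE : steps w = steps_from root w by [].
have arrE i : (i <= size w)%N -> D (arrival w i) = stop w i.
  by move=> ilw; rewrite -duration_arrival// DE.
have arr_ge0 i : 0 <= arrival w i by apply: sumr_ge0 => j _; exact: mdist_ge0.
exists D; split.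
- exists w; split=> //.
  + by move=> v v0; rewrite stepsE; have [-> ->] := cw v v0; rewrite anc_has.
  + move=> i v ilw v0; rewrite stepsE => iE c c0 cv.
    have ist : (i < size (steps_from root w))%N by rewrite size_steps_from.
    have vst : (v, parent v) \in steps_from root w by rewrite -iE mem_nth.
    have cvc : child v c by apply/childP.
    have lt := iw v c v0 cvc vst.
    have le : (index (v, parent v) (steps_from root w) <= i)%N.
      rewrite leqNgt; apply/negP => /(before_find (root, root)).
      by rewrite iE /= eqxx.
    rewrite /traversed; apply/orP; left.
    rewrite in_take_leq//; last by rewrite ltnW.
    exact: leq_trans lt le.
  + move=> i ilw; apply: geodesic_goes_directly => //.
      by move=> s t ts st _; apply: Dlip => //; apply: le_trans ts.
    rewrite !arrE ?(ltnW ilw)// /arrival big_ord_recr/= addrAC subrr add0r.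
    exact: lexx.
- by split.
move=> x; have [x0|x0] := eqVneq (arc_of x) root.
  by rewrite (arc_of_root x0) tour_time_origin D0.
set v := arc_of x in x0 *; have [st1 [st2 [stE]]] := aw v (anc_has v x0).
rewrite -/(origin Q) tour_time_origin add0r => dE.
have sz : (size st1 < size w)%N by rewrite -(size_steps_from root) stE size_cat /= -addSnnS leq_addr.
have eE : nth (root, root) (steps_from root w) (size st1) = (parent v, v).
  by rewrite stE nth_cat ltnn subnn.
move: (eE); rewrite /steps_from nth_zip_cond size_zip /= (minn_idPr _)// sz => -[nu nv].
have D1 : D (start v) = at_node (parent v).
  by rewrite -dE -nu -DE ?(ltnW sz)// stE take_size_cat.
have D2 : D (start v + len v) = at_node v.
  have := DE _ sz; rewrite /= nv => <-; congr D.
  rewrite stE -cat_rcons take_size_cat ?size_rcons// -cats1 duration_cat duration_cons.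
  by rewrite duration_nil addr0 dE /= mdist_arc.
have tx : tau x = start v + offset x by rewrite tour_time_arc.
have /andP[off0 offl] := offset_itv x0; rewrite -/v in offl.
have s0 : 0 <= start v.
  by apply: addr_ge0; [exact: tour_time_ge0|rewrite mulr_ge0// delay_ge0].
have dx : depth x = depth (at_node (parent v)) + offset x by exact: depth_arc.
have dv : depth (at_node v) = depth (at_node (parent v)) + len v by exact: depth_arc.
have lip (a b : R) : 0 <= a -> a <= b -> mdist (D a) (D b) <= b - a.
  move=> a0; rewrite le_eqVlt => /predU1P[->|ab]; last exact: Dlip.
  by rewrite subrr mdistxx.
have L1 : mdist (at_node (parent v)) (D (tau x)) <= offset x.
  by rewrite -D1 tx; apply: le_trans (lip _ _ _ _) _; lra.
have L2 : mdist (at_node v) (D (tau x)) <= len v - offset x.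
  rewrite -D2 tx /mdist/= path_length_sym; apply: le_trans (lip _ _ _ _) _; lra.
have := depth_lip (at_node (parent v)) (D (tau x)); have := depth_lip (at_node v) (D (tau x)).
rewrite !ler_norml => /andP[_ K2] /andP[K1 _].
have dD : depth (D (tau x)) = depth x by lra.
apply: (@precedes_depth_inj _ _ _ _ (at_node v)) => //.
  by apply: precedes_of_depth; rewrite dD; lra.
by rewrite precedesE// -/v covered_node// anc_refl.
Qed.

End tour.
End walks.

(** * Trajectories that lose no time follow a depth-first timetable *)

Section order_of_wasteless.
Context {R : realType} {Q : tree_network R}.
Implicit Types (u v w z : node Q) (x y : location Q) (S : R -> location Q).

Lemma covered_sibling u w x : u != root -> w != root -> parent u = parent w -> u != w ->
  0 < covered x u -> covered x w = 0.
Proof.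
move=> u0 w0 puw nuw; rewrite covered_gt0// => ux.
by apply: covered_eq0 => //; exact: siblings_disjoint ux.
Qed.

Lemma covered_branch_gt0 u z x : u != root -> anc u z -> 0 < covered x z -> 0 < covered x u.
Proof.
move=> u0 uz; rewrite !covered_gt0 ?(anc_root_neq u0 uz)//; exact: anc_trans.
Qed.

(** A position in a sorted list serves as an injective refinement of an order that may have
    ties. *)
Lemma sorting_position (key : node Q -> R) : exists2 pos : node Q -> nat,
  injective pos & forall u w, (pos u < pos w)%N -> key u <= key w.
Proof.
pose le_key a b := key a <= key b; pose s := sort le_key (enum (node Q)).
have mem_s v : v \in s by rewrite mem_sort mem_enum.
exists (fun v => index v s) => [a b ab|u w].
  by rewrite -(nth_index a (mem_s a)) ab nth_index.
have tr : transitive le_key by move=> a b c; exact: le_trans.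
have srt : sorted le_key s by apply: sort_sorted => a b; exact: le_total.
exact: (sorted_ltn_index tr srt).
Qed.

(** By waste_reentry two sibling branches are never interleaved: the one that is entered
    first is completed before the other one is entered. Here pos sorts nodes by the times
    m v at which their arcs are known to have been reached. The time of the first visit to
    x, which is twice the explored length minus the depth of x, can then be computed. *)
Lemma wasteless_tour S t : unit_speed S -> 0 <= t -> waste S t = 0 ->
  (forall v, v != root -> explored S v t = len v) ->
  exists2 pos : node Q -> nat, injective pos & forall x, S (tour_time pos x) = x.
Proof.
move=> sS t0 wt et.
have w0 s : 0 <= s -> s <= t -> waste S s = 0.
  move=> s0 st; apply/eqP; rewrite eq_le waste_ge0// andbT -wt.
  by apply: waste_mono; rewrite ?s0.
have reentry u p q s : u != root -> 0 <= p -> p <= q -> q <= s -> s <= t ->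
    0 < covered (S p) u -> covered (S q) u = 0 -> 0 < covered (S s) u -> False.
  move=> u0 p0 pq qs st cp cq cs; have := waste_reentry sS u0 p0 pq qs cp cq cs.
  by rewrite w0 ?ltxx//; lra.
have vis x : arc_of x != root -> exists2 T, 0 <= T <= t &
    S T = x /\ forall s, 0 <= s -> S s = x -> T <= s.
  move=> x0; apply: first_visit => //; apply/visitedP => //.
  by rewrite et//; case/andP: (offset_itv x0).
have /choice[m mP] : forall v, exists m, v != root -> [/\ 0 <= m, m <= t & arc_of (S m) = v].
  move=> v; have [_|v0] := eqVneq v root; first by exists 0.
  have [|m /andP[m0 mt] [Sm _]] := vis (at_node v); first by [].
  by exists m => _; rewrite Sm.
have mcov v : v != root -> 0 < covered (S (m v)) v.
  by move=> v0; rewrite covered_gt0//; have [_ _ ->] := mP v v0; exact: anc_refl.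
have [pos pos_inj pos_le] := sorting_position m.
have pos_lt u w : u != root -> w != root -> (pos u < pos w)%N -> m u < m w.
  move=> u0 w0' uw; rewrite lt_neqAle pos_le// andbT.
  apply: contraTneq uw => muw; have [_ _ Eu] := mP u u0; have [_ _ Ew] := mP w w0'.
  by rewrite -Eu muw Ew ltnn.
exists pos => // x.
have [x0|x0] := eqVneq (arc_of x) root.
  by rewrite (arc_of_root x0) tour_time_origin sS.1.
have [T /andP[T0 Tt] [ST Tmin]] := vis x x0.
suff -> : tour_time pos x = T by [].
have := w0 T T0 Tt; rewrite /waste ST (explored_total_first sS T0 ST Tmin).
suff -> : \sum_(w | (w != root) && anc w (arc_of x))
     \sum_(u | sibling w u) branch_sum (explored S ^~ T) u =
   \sum_(w | (w != root) && anc w (arc_of x)) delay pos w by rewrite /tour_time; lra.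
apply: eq_bigr => w /andP[w0' wx]; rewrite /delay [RHS]big_mkcondr/=.
apply: eq_bigr => u /and3P[u0 /eqP puw nuw].
have [mu0 mut _] := mP u u0; have [mw0 mwt _] := mP w w0'.
have cxw : 0 < covered x w by rewrite covered_gt0.
have nwu : w != u by rewrite eq_sym.
have cxu : covered x u = 0 by exact: (covered_sibling w0' u0).
have sib_u s : 0 < covered (S s) u -> covered (S s) w = 0.
  exact: covered_sibling.
have sib_w s : 0 < covered (S s) w -> covered (S s) u = 0.
  exact: covered_sibling.
case: ifPn => [/(pos_lt _ _ u0 w0') muw|].
  apply: eq_bigr => z uz; have z0 := anc_root_neq u0 uz.
  apply/eqP; rewrite eq_le; have /andP[_ ->] := explored_itv sS z0 T0.
  rewrite leNgt; apply/negP => lt_len.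
  have [q /andP[q0 qt] [qE _]] := explored_attained sS z0 t0.
  have cq : covered (S q) z = len z by rewrite qE et.
  have cqu : 0 < covered (S q) u.
    by apply: (covered_branch_gt0 u0 uz); rewrite cq len_gt0.
  have Tq : T <= q.
    rewrite leNgt; apply/negP => /ltW qT.
    have : covered (S q) z <= explored S z T by apply: le_explored => //; rewrite q0.
    by rewrite cq leNgt lt_len.
  have [muT|/ltW Tmu] := leP (m u) T.
    by apply: (reentry u (m u) T q) => //; [exact: mcov | rewrite ST].
  apply: (reentry w T (m u) (m w)) => //.
  - exact: ltW.
  - by rewrite ST.
  - by apply: sib_u; exact: mcov.
  - exact: mcov.
rewrite -leqNgt leq_eqVlt => /orP[/eqP/pos_inj E|/(pos_lt _ _ w0' u0) mwu].
  by rewrite E eqxx in nuw.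
apply: big1 => z uz; have z0 := anc_root_neq u0 uz.
apply/eqP; rewrite eq_le; have /andP[-> _] := explored_itv sS z0 T0; rewrite andbT.
rewrite leNgt; apply/negP.
have [q /andP[q0 qT] [<- _]] := explored_attained sS z0 T0.
move=> /(covered_branch_gt0 u0 uz) cq.
have [mwq|/ltW qmw] := leP (m w) q.
  by apply: (reentry w (m w) q T) => //; [exact: mcov | exact: sib_u | rewrite ST].
apply: (reentry u q (m w) (m u)) => //.
- exact: ltW.
- by apply: sib_w; exact: mcov.
- exact: mcov.
Qed.

End order_of_wasteless.

(** * Length and mass of branches *)

Section length.
Context {R : realType} {Q : tree_network R}.
Implicit Types (u v w z : node Q) (x y : location Q).

Lemma measurable_covered v : v != root ->
  measurable_fun setT (fun x : borel Q => covered x v).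
Proof.
move=> v0 _; apply: (measurability _ (RGenOInfty.measurableE R)) => //.
move=> _ [_ [s ->] <-]; rewrite setTI; apply: sub_sigma_algebra.
move=> x /=; rewrite in_itv/= andbT => sx.
rewrite nbhs_ballP; exists (covered x v - s) => /=; first by rewrite subr_gt0.
move=> y; rewrite ballEmdist /= => xy; rewrite in_itv/= andbT.
have := le_covered_mdist x y v0; rewrite ler_norml => /andP[_]; lra.
Qed.

Lemma measurable_covered_gt v s : v != root ->
  measurable ([set x | s < covered x v] : set (borel Q)).
Proof.
move=> v0; have /(_ measurableT _ (measurable_itv `]s, +oo[)) := measurable_covered v0.
by rewrite setTI; congr measurable; apply/seteqP; split => x /=; rewrite in_itv/= andbT.
Qed.

Lemma measurable_covered_le v s : v != root ->
  measurable ([set x | covered x v <= s] : set (borel Q)).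
Proof.
move=> v0; have /(_ measurableT _ (measurable_itv `]-oo, s])) := measurable_covered v0.
by rewrite setTI; congr measurable; apply/seteqP; split => x /=; rewrite in_itv.
Qed.

Lemma measurable_covered_ge v s : v != root ->
  measurable ([set x | s <= covered x v] : set (borel Q)).
Proof.
move=> v0; have /(_ measurableT _ (measurable_itv `[s, +oo[)) := measurable_covered v0.
by rewrite setTI; congr measurable; apply/seteqP; split => x /=; rewrite in_itv/= andbT.
Qed.

Lemma offset_image (A : set (location Q)) v : v != root ->
  (@offset R Q) @` (A `&` [set x | arc_of x = v]) = [set s | 0 < s <= len v /\ A (point v s)].
Proof.
move=> v0; apply/seteqP; split=> [_ [x [Ax /= xv] <-]|s [sv As]] /=.
  by rewrite -xv point_arc; split=> //; apply: offset_itv; rewrite xv.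
by exists (point v s); rewrite ?offset_point//; split=> //=; rewrite arc_of_point.
Qed.

(** The branch of point v s consists of the arcs strictly beyond v and of the part of v from
    s on. *)
Lemma length_branch v s : v != root -> 0 < s <= len v ->
  length_measure (branch (point v s)) = (L v - s)%:E.
Proof.
move=> v0 sv; rewrite /length_measure.
rewrite (eq_bigr (fun u => (if anc v u then len u - (if u == v then s else 0) else 0)%:E)).
  rewrite sumEFin; congr EFin; rewrite -big_mkcondr/=.
  rewrite (eq_bigl (fun u => anc v u)); last first.
    by move=> u; apply: andb_idl; exact: anc_root_neq.
  rewrite sumrB; congr (_ - _); rewrite (bigD1 v)/= ?anc_refl// eqxx big1 ?addr0// => u.
  by case/andP => _ /negbTE ->.
move=> u u0; rewrite offset_image//.
have memE t : 0 < t <= len u -> branch (point v s) (point u t) <-> s <= covered (point u t) v.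
  by move=> tu; rewrite /branch/= precedesE arc_of_point// offset_point.
case: ifPn => [vu|nvu].
  have [uv|nuv] := eqVneq u v.
    subst u.
    rewrite (_ : [set _ | _] = `[s, len v]%classic); last first.
      apply/seteqP; split=> t /=; rewrite in_itv/=.
        by case=> tv /(memE _ tv); rewrite covered_point// => ->; case/andP: tv.
      move=> /andP[st tv]; have tv' : 0 < t <= len v by lra.
      by split=> //; apply/(memE _ tv'); rewrite covered_point.
    rewrite lebesgue_measure_itv/= lte_fin EFinB.
    case: ltP => // ls; have -> : s = len v by apply/eqP; rewrite eq_le ls; case/andP: sv => _ ->.
    by rewrite subee.
  rewrite (_ : [set _ | _] = `]0, len u]%classic); last first.
    apply/seteqP; split=> t /=; rewrite in_itv/=; first by case.
    move=> tu; split=> //; apply/(memE _ tu).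
    rewrite covered_full ?arc_of_point// 1?eq_sym//.
    by case/andP: sv.
  by rewrite lebesgue_measure_itv/= lte_fin len_gt0// sube0 subr0.
rewrite (_ : [set _ | _] = set0) ?measure0//.
rewrite -subset0 => t /= [tu /(memE _ tu)].
by rewrite covered_eq0 ?arc_of_point//; case/andP: sv => + _; lra.
Qed.

Lemma branch_origin : branch (origin Q) = setT.
Proof.
by apply/seteqP; split=> // x _; apply/precedesP => v _; rewrite covered_origin covered_ge0.
Qed.

Lemma length_network : length_measure (branch (origin Q)) = (\sum_(v : node Q | v != root) len v)%:E.
Proof.
rewrite branch_origin /length_measure -sumEFin; apply: eq_bigr => v v0.
rewrite offset_image// (_ : [set _ | _] = `]0, len v]%classic); last first.
  by apply/seteqP; split=> t /=; rewrite in_itv/=; [case|].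
by rewrite lebesgue_measure_itv/= lte_fin len_gt0// sube0.
Qed.

Lemma branch_point v s : v != root -> 0 < s <= len v ->
  branch (point v s) = [set y | s <= covered y v].
Proof.
by move=> v0 sv; apply/seteqP; split=> y; rewrite /branch/= precedesE arc_of_point// offset_point.
Qed.

Lemma len_le_branch_sum v : len v <= L v.
Proof.
rewrite branch_sum_rec lerDl; apply: sumr_ge0 => c _.
by apply: sumr_ge0 => z _; exact: len_ge0.
Qed.

End length.

Section mass.
Context {R : realType} {Q : tree_network R}.
Implicit Types (u v w z : node Q) (x y : location Q).

Variable h : probability (borel Q) R.

Definition mass (A : set (location Q)) : R := fine (h A).

Lemma massK (A : set (borel Q)) : measurable A -> (mass A)%:E = h A.
Proof. by move=> mA; rewrite /mass fineK// fin_num_measure. Qed.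

Lemma mass_ge0 A : 0 <= mass A.
Proof. by rewrite /mass fine_ge0. Qed.

Lemma mass_le (A B : set (borel Q)) : measurable A -> measurable B ->
  A `<=` B -> mass A <= mass B.
Proof. by move=> mA mB AB; rewrite -lee_fin !massK// le_measure ?inE. Qed.

Lemma mass_le1 (A : set (borel Q)) : measurable A -> mass A <= 1.
Proof. by move=> mA; rewrite -lee_fin massK// probability_le1. Qed.

Lemma massDI (A B : set (borel Q)) : measurable A -> measurable B ->
  mass A = mass (A `\` B) + mass (A `&` B).
Proof.
move=> mA mB; apply: EFin_inj; rewrite EFinD !massK//; [|exact: measurableI|exact: measurableD].
exact: measureDI.
Qed.

Lemma mass_sum (I : eqType) (s : seq I) (F : I -> set (borel Q)) (B : set (borel Q)) :
  uniq s -> measurable B -> (forall i, i \in s -> measurable (F i)) ->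
  (forall i j, i \in s -> j \in s -> i != j -> F i `&` F j = set0) ->
  (forall i, i \in s -> F i `<=` B) ->
  \sum_(i <- s) mass (F i) <= mass B.
Proof.
elim: s B => [B _ _ _ _ _|i s IH B /= /andP[nis us] mB mF dF FB].
  by rewrite big_nil mass_ge0.
have mi : measurable (F i) by apply: mF; rewrite mem_head.
have isP j : j \in s -> j \in i :: s by move=> js; rewrite inE js orbT.
rewrite big_cons (massDI mB mi) addrC lerD//.
  apply: IH => //; first exact: measurableD.
  - by move=> j /isP; exact: mF.
  - by move=> j k /isP js /isP ks; exact: dF.
  - move=> j js x Fjx; split; first exact: FB (isP _ js) _ Fjx.
    move=> Fix; have := dF i j (mem_head _ _) (isP _ js).
    rewrite (_ : i != j); last by apply: contraNneq nis => ->.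
    by move=> /(_ isT) E; have : (F i `&` F j) x by []; rewrite E.
rewrite le_eqVlt (_ : B `&` F i = F i) ?eqxx//.
by apply/setIidPr; apply: FB; rewrite mem_head.
Qed.

Definition in_branch v : set (location Q) := [set x | 0 < covered x v].

(** By continuity from below of the measure h: densities are defined for closed branches,
    and the open branch of an arc is the increasing union of such. *)
Lemma open_branch_le v (d M : R) : v != root -> 0 < d ->
  (forall s, 0 < s < d -> mass [set x | s <= covered x v] <= M) ->
  mass (in_branch v) <= M.
Proof.
move=> v0 d0 H; (* n.+2 rather than n.+1, for the bound to be less than d *)
pose F n : set (borel Q) := [set x | d / n.+2%:R <= covered x v].
have mF n : measurable (F n) by exact: measurable_covered_ge.
have FE : \bigcup_n F n = in_branch v.
  apply/seteqP; split=> [x [n _ /=]|x /= cx].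
    by apply: lt_le_trans; rewrite divr_gt0.
  exists (Num.truncn (d / covered x v)) => //=.
  rewrite /F/= ler_pdivrMr// mulrC -ler_pdivrMr//.
  by apply: ltW; apply: lt_trans (truncnS_gt _) _; rewrite ltr_nat.
have mU : measurable (\bigcup_n F n) by exact: bigcup_measurable.
have ndF : nondecreasing_seq F.
  move=> m n mn; apply/subsetPset => x /=; apply: le_trans.
  by rewrite ler_pM2l// lef_pV2 ?posrE// ler_nat.
have := @nondecreasing_cvg_mu _ _ _ h _ mF mU ndF; rewrite FE => hF.
have mb : measurable (in_branch v : set (borel Q)) by exact: measurable_covered_gt.
rewrite -lee_fin massK//; apply: (cvge_to_le hF); apply: nearW => n /=.
rewrite -(massK (mF n)) lee_fin; apply: H; rewrite divr_gt0//=.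
by rewrite ltr_pdivrMr// ltr_pMr// ltr1n.
Qed.

Hypothesis hmono : monotone_distribution h.

Lemma branch_density v w s t : v != root -> anc v w -> 0 < s < len v ->
  0 < t <= len w -> (v = w -> s <= t) -> t < L w ->
  mass [set x | s <= covered x v] * (L w - t) <= mass [set x | t <= covered x w] * (L v - s).
Proof.
move=> v0 vw sv tw vwst tL.
have w0 := anc_root_neq v0 vw.
have sv' : 0 < s <= len v by case/andP: sv => -> /ltW.
have := @hmono (point v s) (point w t).
rewrite /density !length_branch// !branch_point// -!/(mass _) lte_fin subr_gt0 => H.
have := H _ tL; rewrite ler_pdivrMr ?subr_gt0; last first.
  by apply: lt_le_trans (len_le_branch_sum v); case/andP: sv.
rewrite mulrAC ler_pdivlMr ?subr_gt0//; apply.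
apply/precedesE; rewrite arc_of_point// offset_point//.
have [E|nvw] := eqVneq v w.
  by rewrite -E covered_point// ?vwst// E.
by rewrite covered_full ?arc_of_point//; case/andP: sv'.
Qed.

Lemma total_density w t : w != root -> 0 < t <= len w -> t < L w ->
  L w - t <= mass [set x | t <= covered x w] * \sum_(v : node Q | v != root) len v.
Proof.
move=> w0 tw tL; have := @hmono (origin Q) (point w t).
rewrite /density length_network length_branch// branch_origin branch_point//.
rewrite probability_setT /= -/(mass _) lte_fin subr_gt0 => /(_ _ tL).
rewrite div1r ler_pdivlMr ?subr_gt0// mulrC ler_pdivrMr; last first.
  by rewrite (bigD1 w)//= ltr_pwDl ?len_gt0// sumr_ge0// => z _; exact: len_ge0.
apply; apply/precedesP => v _; rewrite covered_origin; exact: covered_ge0.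
Qed.

End mass.

(** * Consequences of monotonicity *)

Section monotone.
Context {R : realType} {Q : tree_network R}.
Implicit Types (u v w z : node Q) (x y : location Q).

Variable h : probability (borel Q) R.
Hypothesis hmono : monotone_distribution h.
Local Notation mass := (mass h).
Local Notation H v := (mass (in_branch v)).

(** The part of the branch of w situated beyond the distance k on its first arc is at least
    as dense as the whole branch of v. This is monotonicity, extended to half-open branches by
    letting closed ones grow. *)
Lemma branch_mass v w k : v != root -> anc v w -> 0 <= k < len w ->
  H v * (L w - k) <= L v * mass [set x | k < covered x w].
Proof.
move=> v0 vw /andP[k0 kw]; have w0 := anc_root_neq v0 vw.
set M := mass [set x | k < covered x w].
have Hv0 : 0 <= H v by exact: mass_ge0.
have Hv1 : H v <= 1 by apply: mass_le1; exact: measurable_covered_gt.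
have step t : k < t < len w -> H v * (L w - t) <= L v * M.
  move=> /andP[kt tw]; have tL : t < L w by apply: lt_le_trans (len_le_branch_sum w).
  have t0 : 0 < t by lra.
  rewrite -ler_pdivlMr ?subr_gt0//.
  have d0 : 0 < Num.min (len v) t by rewrite lt_min t0 len_gt0.
  apply: (open_branch_le v0 d0) => s; rewrite lt_min => /and3P[s0 sv st].
  rewrite ler_pdivlMr ?subr_gt0//.
  have := @branch_density _ _ h hmono v w s t v0 vw; rewrite s0 sv t0 (ltW tw).
  move=> /(_ isT isT (fun _ => ltW st) tL)/le_trans; apply.
  have Mt : mass [set x | t <= covered x w] <= M.
    apply: mass_le; [exact: measurable_covered_ge|exact: measurable_covered_gt|].
    by move=> x /=; exact: lt_le_trans.
  rewrite mulrC ler_pM ?mass_ge0//; last by rewrite lerBlDr lerDl ltW.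
  by rewrite subr_ge0; apply: le_trans (ltW sv) (len_le_branch_sum v).
apply/ler_addgt0Pr => e e0.
(* approach k from above, within e, while staying inside the arc *)
pose d := Num.min e ((len w - k) / 2).
have d0 : 0 < d by rewrite lt_min e0 divr_gt0// subr_gt0.
have de : d <= e by rewrite ge_min lexx.
have dl : d <= (len w - k) / 2 by rewrite ge_min lexx orbT.
have := step (k + d); have -> : k < k + d < len w by lra.
move=> /(_ isT) Hs; apply: le_trans (_ : H v * (L w - (k + d)) + H v * d <= _).
  by rewrite -mulrDr; apply: ler_wpM2l => //; lra.
by apply: lerD => //; apply: le_trans de; rewrite ler_piMl// ltW.
Qed.

(** By monotonicity the density of each branch is at least that of the whole network, which
    is positive. *)
Lemma mass_beyond_gt0 v k : v != root -> 0 <= k < len v -> 0 < mass [set x | k < covered x v].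
Proof.
move=> v0 /andP[k0 kv]; pose t := (k + len v) / 2.
have kt : k < t < len v by rewrite /t; lra.
have tL : t < L v by apply: lt_le_trans (len_le_branch_sum v); case/andP: kt.
have tv : 0 < t <= len v by lra.
have := total_density hmono v0 tv tL => le.
apply: lt_le_trans (_ : mass [set x | t <= covered x v] <= _); last first.
  apply: mass_le; [exact: measurable_covered_ge|exact: measurable_covered_gt|].
  by move=> x /=; apply: lt_le_trans; case/andP: kt.
rewrite lt_neqAle mass_ge0 andbT; apply: contraTneq le => <-.
by rewrite mul0r -ltNge subr_gt0.
Qed.

Section residual.
Variable k : node Q -> R.
Hypothesis k_itv : forall z, z != root -> 0 <= k z <= len z.
Hypothesis k_tree : forall w z, w != root -> anc w z -> z != w -> k w < len w -> k z = 0.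
Let K : set (location Q) := [set x | forall z, z != root -> covered x z <= k z].

Lemma measurable_explored_set : measurable (K : set (borel Q)).
Proof.
have -> : K = \bigcap_(z in [set z | z != root]) [set x | covered x z <= k z] by [].
apply: fin_bigcap_measurable => [|z /= z0]; last exact: measurable_covered_le.
exact: finite_finset.
Qed.

Let mK := measurable_explored_set.

Lemma measurable_in_branch u : u != root -> measurable (in_branch u : set (borel Q)).
Proof. exact: measurable_covered_gt. Qed.

(** What remains of a branch when an initial part of it has been explored is a disjoint
    union of branches, each at least as dense as the branch of v. By induction from the
    leaves to the root. *)
Lemma residual_mass v w : v != root -> anc v w ->
  H v * branch_sum (fun z => len z - k z) w <= L v * mass (in_branch w `\` K).
Proof.
move=> v0; elim/(@tree_ind_up _ Q): w => w IH vw; have w0 := anc_root_neq v0 vw.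
have [kw|kw] := ltP (k w) (len w).
  have -> : branch_sum (fun z => len z - k z) w = L w - k w.
    rewrite /branch_sum sumrB; congr (_ - _).
    rewrite (bigD1 w) ?anc_refl//= big1 ?addr0// => z /andP[wz zw].
    exact: k_tree zw kw.
  have /andP[k0 _] := k_itv w0.
  have kw' : 0 <= k w < len w by rewrite k0.
  apply: le_trans (branch_mass v0 vw kw') _.
  apply: ler_wpM2l; first exact: branch_sum_len_ge0.
  apply: mass_le; first exact: measurable_covered_gt.
    by apply: measurableD => //; exact: measurable_in_branch.
  move=> x /= kx; split; first exact: le_lt_trans kx.
  by move=> /(_ w w0); rewrite leNgt kx.
have kE : k w = len w by apply/eqP; rewrite eq_le kw andbT; case/andP: (k_itv w0).
rewrite branch_sum_rec kE subrr add0r mulr_sumr.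
apply: le_trans (_ : \sum_(c | child w c) L v * mass (in_branch c `\` K) <= _).
  apply: ler_sum => c cw; apply: IH => //; apply: anc_trans vw _.
  by have /childP[_ <-] := cw; exact: anc_parent.
rewrite -mulr_sumr; apply: ler_wpM2l; first exact: branch_sum_len_ge0.
rewrite -big_enum; apply: (@mass_sum _ _ h _ _ (fun c => in_branch c `\` K)).
- exact: enum_uniq.
- by apply: measurableD => //; exact: measurable_in_branch.
- move=> c; rewrite mem_enum => /childP[c0 _].
  by apply: measurableD => //; exact: measurable_in_branch.
- move=> c c'; rewrite !mem_enum => /childP[c0 cw] /childP[c'0 c'w] ncc'.
  rewrite -subset0 => x /= [[cx _] [c'x _]].
  have := @siblings_disjoint _ _ c c' (arc_of x) c0 c'0; rewrite cw c'w => /(_ erefl ncc').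
  by move: cx c'x; rewrite /in_branch/= !covered_gt0// => -> -> /(_ isT).
- move=> c; rewrite mem_enum => /childP[c0 cw] x /= [cx nKx]; split=> //.
  move: cx; rewrite /in_branch/= !covered_gt0//; apply: anc_trans.
  by rewrite -cw anc_parent.
Qed.

(** The complement of residual_mass: what is explored first of a branch is at most as dense
    as the branch itself. *)
Lemma explored_mass v : v != root -> L v * mass (in_branch v `&` K) <= H v * branch_sum k v.
Proof.
move=> v0; have := residual_mass v0 (anc_refl v).
have mv := measurable_in_branch v0.
rewrite {1}/branch_sum sumrB -/(L v) -/(branch_sum k v).
have := @massDI _ _ h _ _ mv mK; set a := mass _; set b := mass _; set c := mass _.
move=> -> /=; rewrite /c; nra.
Qed.

End residual.
End monotone.

(** * The order of the visits to two independent points *)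

Section comparison.
Context {d} {T : measurableType d} {R : realType}.
Local Open Scope ereal_scope.

(** The integrals are the probabilities, for X and Y independent of law P in A and in B, that
    Y precedes X and that X precedes Y. One of the two events happens, and Tonelli's theorem
    turns the second one into an integral over B. *)
Lemma comparison_integral (P : {sigma_finite_measure set T -> \bar R}) (f : T -> \bar R) (A B : set T) :
  measurable_fun setT f -> measurable A -> measurable B ->
  P A * P B <= \int[P]_(x in A) P (B `&` [set y | f y <= f x]) +
               \int[P]_(x in B) P (A `&` [set y | f y <= f x]).
Proof.
move=> mf mA mB.
have mle : measurable [set p : T * T | f p.2 <= f p.1].
  rewrite -[X in measurable X]setTI; apply: measurable_lee => //.
    exact: measurableT_comp.
  exact: measurableT_comp.
have mge : measurable [set p : T * T | f p.1 <= f p.2].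
  rewrite -[X in measurable X]setTI; apply: measurable_lee => //.
    exact: measurableT_comp.
  exact: measurableT_comp.
pose E1 := A `*` B `&` [set p : T * T | f p.2 <= f p.1].
pose E2 := A `*` B `&` [set p : T * T | f p.1 <= f p.2].
have mAB : measurable (A `*` B) by exact: measurableX.
have mE1 : measurable E1 by exact: measurableI.
have mE2 : measurable E2 by exact: measurableI.
rewrite -product_measure1E//.
have -> : A `*` B = E1 `|` E2.
  rewrite /E1 /E2 -setIUr; apply/esym/setIidPl => p _ /=.
  by apply/orP; exact: le_total.
apply: le_trans (measureU2 _ mE1 mE2) _; apply: leeD.
  rewrite /product_measure1 [in leRHS]integral_mkcond.
  rewrite le_eqVlt; apply/orP; left; apply/eqP; apply: eq_integral => x _ /=.
  rewrite patchE; case: ifPn => xA.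
    congr (P _); apply/seteqP; split=> y; rewrite /xsection/= inE /E1/=; first by case=> -[].
    by case=> By fyx; do ! split=> //; rewrite inE in xA.
  rewrite (_ : xsection _ _ = set0) ?measure0// -subset0 => y.
  by rewrite /xsection/= inE => -[[/= xA' _] _]; rewrite notin_setE in xA.
rewrite /=; have -> : (P \x P) E2 = (P \x^ P) E2.
  by apply: product_measure_unique => //= ? ? ? ?; rewrite product_measure2E.
rewrite /product_measure2 [in leRHS]integral_mkcond.
rewrite le_eqVlt; apply/orP; left; apply/eqP; apply: eq_integral => x _ /=.
rewrite patchE; case: ifPn => xB.
  congr (P _); apply/seteqP; split=> y; rewrite /ysection/= inE /E2/=; first by case=> -[].
  by case=> By fyx; do ! split=> //; rewrite inE in xB.
rewrite (_ : ysection _ _ = set0) ?measure0// -subset0 => y.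
by rewrite /ysection/= inE => -[[/= _ xB'] _]; rewrite notin_setE in xB.
Qed.

Lemma measurable_comparison (P : {sigma_finite_measure set T -> \bar R}) (f : T -> \bar R) (B : set T) :
  measurable_fun setT f -> measurable B ->
  measurable_fun setT (fun x => P (B `&` [set y | f y <= f x])).
Proof.
move=> mf mB.
have mle : measurable [set p : T * T | f p.2 <= f p.1].
  rewrite -[X in measurable X]setTI; apply: measurable_lee => //.
    exact: measurableT_comp.
  exact: measurableT_comp.
pose E1 := setT `*` B `&` [set p : T * T | f p.2 <= f p.1].
have mE1 : measurable E1 by apply: measurableI => //; exact: measurableX.
have := measurable_fun_xsection P mE1.
congr measurable_fun; apply/funext => x /=; congr (P _).
by apply/seteqP; split=> y; rewrite /xsection/= inE /E1/= => -[] // [].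
Qed.

End comparison.

(** * A lower bound on hitting times *)

Section expected_time.
Context {R : realType} {Q : tree_network R}.
Implicit Types (u v w z : node Q) (x y : location Q).

Variable h : probability (borel Q) R.
Hypothesis hmono : monotone_distribution h.
Local Notation mass := (mass h).
Local Notation H v := (mass (in_branch v)).

Lemma branch_mass_gt0 v : v != root -> 0 < H v.
Proof. by move=> v0; apply: mass_beyond_gt0 => //; rewrite lexx len_gt0. Qed.

Lemma measurable_depth : measurable_fun setT (fun x : borel Q => depth x).
Proof.
rewrite /depth; under eq_fun do rewrite big_mkcond/=.
apply: measurable_sum => v; case: (eqVneq v root) => [_|v0]/=.
  exact: measurable_cst.
exact: measurable_covered.
Qed.

Lemma visited_coveredP S x t : unit_speed S -> 0 <= t ->
  visited S t x <-> forall v, v != root -> covered x v <= explored S v t.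
Proof.
move=> sS t0; split=> [[s st <-] v v0|xk]; first exact: le_explored.
have [/arc_of_root ->|x0] := eqVneq (arc_of x) root.
  by exists 0; rewrite ?lexx ?t0// sS.1.
by apply/visitedP => //; rewrite -covered_arc; exact: xk.
Qed.

Section search.
Variable S : R -> location Q.
Hypothesis speedS : unit_speed S.

Lemma explored_tree t w z : 0 <= t -> w != root -> anc w z -> z != w ->
  explored S w t < len w -> explored S z t = 0.
Proof.
move=> t0 w0 wz zw lt; have z0 := anc_root_neq w0 wz.
have [q qt [<- _]] := explored_attained speedS z0 t0.
apply/eqP; rewrite eq_le covered_ge0 andbT leNgt; apply/negP => cq.
have cw := covered_anc z0 cq wz; move: lt; rewrite ltNge; apply/negP/negPn.
by rewrite -cw 1?eq_sym//; exact: le_explored.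
Qed.

Lemma hitting_time_leE (t : R) : 0 <= t ->
  [set x | (hitting_time S x <= t%:E)%E] =
  [set x | forall v, v != root -> covered x v <= explored S v t].
Proof.
move=> t0; apply/seteqP; split=> x /=.
  by move/(hitting_timeP speedS _ t0)/(visited_coveredP _ speedS t0).
by move/(visited_coveredP _ speedS t0)/(hitting_timeP speedS _ t0).
Qed.

Lemma measurable_hitting_time : measurable_fun setT (hitting_time S : borel Q -> \bar R).
Proof.
move=> _; apply: (measurability _ (ErealGenOInfty.measurableE R)) => //.
move=> _ [_ [t ->] <-]; rewrite setTI.
have -> : (hitting_time S @^-1` `]t%:E, +oo[%classic) =
    ~` [set x : borel Q | (hitting_time S x <= t%:E)%E].
  by apply/seteqP; split=> x /=; rewrite in_itv/= andbT ltNge => /negP.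
apply: measurableC; have [t0|t0] := leP 0 t.
  by rewrite hitting_time_leE//; exact: measurable_explored_set.
rewrite (_ : [set _ | _] = set0)// -subset0 => x /= /(le_trans (hitting_time_ge0 S x)).
by rewrite lee_fin leNgt t0.
Qed.

Definition earlier u x : R := mass (in_branch u `&` [set y | (hitting_time S y <= hitting_time S x)%E]).

(** The explored length of the branch of u at the hitting time of x is at least L u / H u times
    its explored mass, by explored_mass. This form of the bound involves only the measure h,
    so that the contributions of two siblings can be compared by Tonelli's theorem. *)
Definition lower_time x : R := depth x + \sum_(w | w != root) \sum_(u | sibling w u)
  2 * (L u / H u) * (\1_(in_branch w) x * earlier u x).

Lemma indic_branch w x : w != root -> \1_(in_branch w) x = (anc w (arc_of x))%:R :> R.
Proof.
move=> w0; rewrite indicE -covered_gt0//; congr (nat_of_bool _)%:R.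
by apply/idP/idP; rewrite inE.
Qed.

(** The bound holds with an additional waste, which is what makes it strict for searches
    that lose time. *)
Lemma lower_time_waste t : 0 <= t -> hitting_time S (S t) = t%:E ->
  lower_time (S t) + waste S t <= t.
Proof.
move=> t0 tE; set x := S t.
have := explored_total_ge speedS t0; rewrite -/x => total.
suff : \sum_(w | w != root) \sum_(u | sibling w u)
    (L u / H u) * (\1_(in_branch w) x * earlier u x) <=
  \sum_(w | (w != root) && anc w (arc_of x)) \sum_(u | sibling w u) branch_sum (explored S ^~ t) u.
  have -> : lower_time x = depth x + 2 * \sum_(w | w != root) \sum_(u | sibling w u)
      (L u / H u) * (\1_(in_branch w) x * earlier u x).
    rewrite /lower_time mulr_sumr; congr (_ + _); apply: eq_bigr => w _.
    by rewrite mulr_sumr; apply: eq_bigr => u _; rewrite -[LHS]mulrA.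
  rewrite /waste -/x; lra.
rewrite big_mkcondr/=; apply: ler_sum => w w0.
rewrite indic_branch//; case: ifPn => wx; last by rewrite big1// => u _; rewrite mul0r mulr0.
apply: ler_sum => u /and3P[u0 _ _]; rewrite mul1r /earlier tE hitting_time_leE//.
have := @explored_mass _ _ h hmono (explored S ^~ t) _ _ u u0.
rewrite mulrAC ler_pdivrMr ?branch_mass_gt0// [leRHS]mulrC; apply.
- by move=> z z0; exact: explored_itv.
- by move=> w' z w'0 w'z zw'; exact: explored_tree.
Qed.

Lemma hitting_time_case x : hitting_time S x = +oo%E \/
  exists2 t, 0 <= t & S t = x /\ hitting_time S x = t%:E.
Proof.
have := hitting_time_ge0 S x; case E : (hitting_time S x) => [t| |]// t0; last by left.
right; rewrite lee_fin in t0.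
have [s /andP[s0 st] Ss] : visited S t x by apply/hitting_timeP; rewrite ?E.
exists t => //; split=> //; suff <- : s = t by [].
apply/eqP; rewrite eq_le st -lee_fin -E; apply/hitting_timeP => //.
by exists s; rewrite ?s0 ?lexx.
Qed.

Lemma lower_time_le x : ((lower_time x)%:E <= hitting_time S x)%E.
Proof.
have [->|[t t0 [Sx tE]]] := hitting_time_case x; first exact: leey.
subst x; rewrite tE lee_fin; have := lower_time_waste t0 tE.
by have := waste_ge0 speedS t0; lra.
Qed.

Lemma lower_time_tight x : hitting_time S x = (lower_time x)%:E ->
  exists2 t, 0 <= t & waste S t = 0 /\ S t = x.
Proof.
have [->//|[t t0 [Sx tE]]] := hitting_time_case x.
subst x; rewrite tE => -[tl]; exists t => //; split=> //.
have := lower_time_waste t0 tE; rewrite -tl.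
by have := waste_ge0 speedS t0; lra.
Qed.

Lemma earlier_itv u x : u != root -> 0 <= earlier u x <= 1.
Proof.
move=> u0; rewrite mass_ge0 mass_le1//; apply: measurableI; first exact: measurable_in_branch.
rewrite -[X in measurable X]setTI; apply: measurable_lee => //.
exact: measurable_hitting_time.
Qed.

Lemma earlierK u x : u != root -> (earlier u x)%:E =
  h (in_branch u `&` [set y | (hitting_time S y <= hitting_time S x)%E]).
Proof.
move=> u0; rewrite /earlier massK//; apply: measurableI; first exact: measurable_in_branch.
rewrite -[X in measurable X]setTI; apply: measurable_lee => //.
exact: measurable_hitting_time.
Qed.

Lemma measurable_earlier u : u != root -> measurable_fun setT (earlier u : borel Q -> R).
Proof.
move=> u0; apply/measurable_EFinP.
rewrite (_ : EFin \o _ = fun x : borel Q => h (in_branch u `&`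
   [set y | (hitting_time S y <= hitting_time S x)%E])).
  apply: measurable_comparison; [exact: measurable_hitting_time|exact: measurable_in_branch].
by apply/funext => x /=; rewrite earlierK.
Qed.

End search.

End expected_time.

(** * Expected times *)

Section integral_sum.
Context {d} {T : measurableType d} {R : realType} (mu : {measure set T -> \bar R}).

Lemma integral_combination (I : finType) (P : pred I) (g : T -> R) (c : I -> R)
    (f : I -> T -> R) (G : R) (F : I -> R) :
  measurable_fun setT g -> (forall x, 0 <= g x) -> (\int[mu]_x (g x)%:E = G%:E)%E ->
  (forall i, P i -> 0 <= c i) -> (forall i, P i -> measurable_fun setT (f i)) ->
  (forall i, P i -> forall x, 0 <= f i x) ->
  (forall i, P i -> \int[mu]_x (f i x)%:E = (F i)%:E)%E ->
  (\int[mu]_x (g x + \sum_(i | P i) c i * f i x)%:E = (G + \sum_(i | P i) c i * F i)%:E)%E.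
Proof.
move=> mg g0 gG c0 mf f0 fF.
pose t i x : \bar R := (if P i then c i * f i x else 0)%:E.
have t0 i x : (0 <= t i x)%E.
  by rewrite lee_fin; case: ifP => // Pi; rewrite mulr_ge0 ?c0 ?f0.
have mt i : measurable_fun setT (t i).
  apply/measurable_EFinP; case: (boolP (P i)) => Pi; last exact: measurable_cst.
  by apply: measurable_funM; [exact: measurable_cst|exact: mf].
transitivity (\int[mu]_x ((g x)%:E + \sum_(i <- index_enum I) t i x))%E.
  by apply: eq_integral => x _; rewrite EFinD big_mkcond -sumEFin.
rewrite ge0_integralD//; last 4 first.
- by move=> x _; rewrite lee_fin.
- exact/measurable_EFinP.
- by move=> x _; apply: sume_ge0 => i _; exact: t0.
- by apply: emeasurable_sum => i; exact: mt.
rewrite gG ge0_integral_sum// EFinD; congr (_ + _)%E.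
rewrite [in RHS]big_mkcond -sumEFin; apply: eq_bigr => i _; rewrite /t.
case: (boolP (P i)) => Pi; last exact: integral0.
under eq_integral do rewrite EFinM.
rewrite ge0_integralZl_EFin ?c0//; first by rewrite fF// EFinM.
- by move=> x _; rewrite lee_fin f0.
- by apply/measurable_EFinP; exact: mf.
Qed.

End integral_sum.

Section optimality.
Context {R : realType} {Q : tree_network R}.
Implicit Types (u v w z : node Q) (x y : location Q).

Variable h : probability (borel Q) R.
Hypothesis hmono : monotone_distribution h.
Local Notation mass := (mass h).
Local Notation H v := (mass (in_branch v)).

Lemma depth_ge0 x : 0 <= depth x.
Proof. by apply: sumr_ge0 => v _; exact: covered_ge0. Qed.

Lemma depth_le x : depth x <= \sum_(v : node Q | v != root) len v.
Proof. by apply: ler_sum => v _; exact: covered_le_len. Qed.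

Lemma integral_bounded (f : borel Q -> R) (M : R) : measurable_fun setT f ->
  (forall x, 0 <= f x <= M) -> exists2 I, (\int[h]_x (f x)%:E = I%:E)%E & 0 <= I <= M.
Proof.
move=> mf fM; have I0 : (0 <= \int[h]_x (f x)%:E)%E.
  by apply: integral_ge0 => x _; rewrite lee_fin; case/andP: (fM x).
have IM : (\int[h]_x (f x)%:E <= M%:E)%E.
  apply: le_trans (_ : \int[h]_x (cst M%:E x) <= _)%E.
    apply: ge0_le_integral => //.
    - by move=> x _; rewrite lee_fin; case/andP: (fM x).
    - exact/measurable_EFinP.
    - by move=> x _; rewrite lee_fin; case/andP: (fM x).
  by rewrite integral_cst//= probability_setT mule1.
have fin : (\int[h]_x (f x)%:E)%E \is a fin_num.
  by rewrite ge0_fin_numE// (le_lt_trans IM) ?ltry.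
exists (fine (\int[h]_x (f x)%:E)); first by rewrite fineK.
by rewrite fine_ge0//= -lee_fin fineK.
Qed.

Definition mean_depth : R := fine (\int[h]_x (depth x)%:E).

Lemma mean_depthE : (\int[h]_x (depth x)%:E = mean_depth%:E)%E.
Proof.
have [|I E _] := integral_bounded (M := \sum_(v : node Q | v != root) len v) (measurable_depth (Q := Q)).
  by move=> x; rewrite depth_ge0 depth_le.
by rewrite /mean_depth E.
Qed.

Lemma tour_timeE pos x : tour_time pos x =
  depth x + \sum_(w | w != root) 2 * delay pos w * \1_(in_branch w) x.
Proof.
rewrite /tour_time; congr (_ + _); rewrite mulr_sumr big_mkcondr/=; apply: eq_bigr => w w0.
by rewrite indic_branch//; case: ifP; rewrite ?mulr1// mulr0.
Qed.

Lemma measurable_tour_time pos : measurable_fun setT (tour_time pos : borel Q -> R).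
Proof.
rewrite (funext (tour_timeE pos)); apply: measurable_funD; first exact: measurable_depth.
under eq_fun do rewrite big_mkcond/=.
apply: measurable_sum => w; case: (eqVneq w root) => [_|w0]/=; first exact: measurable_cst.
apply: measurable_funM; first exact: measurable_cst.
by apply: measurable_indic; exact: measurable_in_branch.
Qed.

Lemma integral_tour_time pos : (\int[h]_x (tour_time pos x)%:E =
  (mean_depth + \sum_(w | w != root) 2 * delay pos w * H w)%:E)%E.
Proof.
rewrite -(@integral_combination _ _ _ h _ (fun w => w != root) (@depth R Q) (fun w => 2 * delay pos w)
  (fun w x => \1_(in_branch w) x) mean_depth (fun w => H w)) //.
- by apply: eq_integral => x _; rewrite tour_timeE.
- exact: measurable_depth.
- exact: depth_ge0.
- exact: mean_depthE.
- by move=> w _; rewrite mulr_ge0// delay_ge0.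
- by move=> w w0; apply: measurable_indic; exact: measurable_in_branch.
- move=> w w0; rewrite integral_indic//; last exact: measurable_in_branch.
  by rewrite setIT massK//; exact: measurable_in_branch.
Qed.

Section search.
Variable S : R -> location Q.
Hypothesis speedS : unit_speed S.

Definition precedence u w : R := fine (\int[h]_x (\1_(in_branch w) x * earlier h S u x)%:E).

Lemma measurable_precedence u w : u != root -> w != root ->
  measurable_fun setT (fun x : borel Q => \1_(in_branch w) x * earlier h S u x).
Proof.
move=> u0 w0; apply: measurable_funM; last exact: measurable_earlier.
by apply: measurable_indic; exact: measurable_in_branch.
Qed.

Lemma precedenceE u w : u != root -> w != root ->
  (\int[h]_x (\1_(in_branch w) x * earlier h S u x)%:E = (precedence u w)%:E)%E.
Proof.
move=> u0 w0; have [|I E _] := integral_bounded (M := 1) (measurable_precedence u0 w0).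
  move=> x; have /andP[e0 e1] := earlier_itv h speedS x u0.
  by rewrite indic_branch//; case: (anc _ _); rewrite ?mul1r ?mul0r ?e0//= lexx ler01.
by rewrite /precedence E.
Qed.

Lemma precedence_branch u w : u != root -> w != root -> ((precedence u w)%:E =
  \int[h]_(x in in_branch w) h (in_branch u `&`
    [set y | (hitting_time S y <= hitting_time S x)%E]))%E.
Proof.
move=> u0 w0; rewrite -precedenceE// [RHS]integral_mkcond; apply: eq_integral => x _.
rewrite patchE indicE; case: ifP => _; last by rewrite mul0r.
by rewrite mul1r earlierK.
Qed.

Lemma precedence_sum u w : u != root -> w != root ->
  H u * H w <= precedence u w + precedence w u.
Proof.
move=> u0 w0; rewrite -lee_fin EFinM EFinD !precedence_branch// muleC.
rewrite !massK//; try exact: measurable_in_branch.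
apply: comparison_integral; try exact: measurable_in_branch.
exact: measurable_hitting_time.
Qed.

Lemma integral_lower_time : (\int[h]_x (lower_time h S x)%:E = (mean_depth +
  \sum_(w | w != root) \sum_(u | sibling w u) 2 * (L u / H u) * precedence u w)%:E)%E.
Proof.
rewrite pair_big_dep/=.
rewrite -(@integral_combination _ _ _ h _ (fun p => (p.1 != root) && sibling p.1 p.2)
  (@depth R Q) (fun p : node Q * node Q => 2 * (L p.2 / H p.2))
  (fun p x => \1_(in_branch p.1) x * earlier h S p.2 x) mean_depth (fun p => precedence p.2 p.1)) //.
- apply: eq_integral => x _; congr EFin; rewrite /lower_time; congr (_ + _).
  by rewrite pair_big_dep.
- exact: measurable_depth.
- exact: depth_ge0.
- exact: mean_depthE.
- case=> w u /= _; rewrite mulr_ge0// divr_ge0 ?branch_sum_len_ge0 ?mass_ge0//.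
- by case=> w u /= /andP[w0 /and3P[u0 _ _]]; exact: measurable_precedence.
- case=> w u /= /andP[w0 /and3P[u0 _ _]] x; rewrite mulr_ge0//.
  by case/andP: (earlier_itv h speedS x u0).
- by case=> w u /= /andP[w0 /and3P[u0 _ _]]; exact: precedenceE.
Qed.

End search.

(** Denser branches come first: L u / H u is the inverse of the density of the branch of
    u. *)
Definition density_order (pos : node Q -> nat) : Prop :=
  forall u w, (pos u < pos w)%N -> L u / H u <= L w / H w.

(** Branch against branch. For siblings u and w the two terms precedence S u w and
    precedence S w u add up to at least H u * H w, and the smaller of the coefficients L u / H u
    and L w / H w belongs to the one that is visited first. *)
Lemma tour_time_optimal S pos : unit_speed S -> injective pos -> density_order pos ->
  \sum_(w | w != root) 2 * delay pos w * H w <=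
  \sum_(w | w != root) \sum_(u | sibling w u) 2 * (L u / H u) * precedence S u w.
Proof.
move=> sS pos_inj dpos; pose a u := L u / H u.
pose pr w u := [&& w != root, sibling w u & (pos u < pos w)%N].
have -> : \sum_(w | w != root) \sum_(u | sibling w u) 2 * (L u / H u) * precedence S u w =
  \sum_(w | w != root) \sum_(u | sibling w u && (pos u < pos w)%N)
    2 * (a u * precedence S u w + a w * precedence S w u).
  transitivity (\sum_(w | w != root) (\sum_(u | sibling w u && (pos u < pos w)%N)
      2 * (a u * precedence S u w) + \sum_(u | sibling w u && (pos w < pos u)%N)
      2 * (a u * precedence S u w))).
    apply: eq_bigr => w w0; rewrite (bigID (fun u => (pos u < pos w)%N))/=; congr (_ + _).
      by apply: eq_bigr => u _; rewrite -mulrA.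
    apply: eq_big => [u|u _]; last by rewrite -mulrA.
    case: (boolP (sibling w u)) => //= /and3P[_ _ nuw]; rewrite -leqNgt leq_eqVlt.
    by rewrite (_ : (pos w == pos u) = false)//; apply: contraNF nuw => /eqP/pos_inj ->.
  rewrite big_split/= [X in _ + X](exchange_big_dep (fun u => u != root))/=; last first.
    by move=> w u _ /andP[/and3P[]].
  rewrite -big_split/=; apply: eq_bigr => w w0.
  rewrite [X in _ + X](eq_bigl (fun u => sibling w u && (pos u < pos w)%N)); last first.
    move=> u; case: (eqVneq u root) => [->|u0]/=; first by rewrite /sibling/= eqxx.
    by rewrite siblingC.
  by rewrite -big_split/=; apply: eq_bigr => u _; rewrite mulrDr.
apply: ler_sum => w w0; rewrite /delay -mulrA mulr_suml mulr_sumr.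
apply: ler_sum => u /andP[/and3P[u0 _ _] uw].
have Hu := branch_mass_gt0 hmono u0.
have pwu : 0 <= precedence S w u.
  rewrite -lee_fin -precedenceE//; apply: integral_ge0 => x _; rewrite lee_fin mulr_ge0//.
  exact: mass_ge0.
have -> : L u * H w = a u * (H u * H w) by rewrite /a mulrA divfK ?gt_eqF.
have a0 : 0 <= a u by rewrite divr_ge0 ?branch_sum_len_ge0 ?ltW.
have := ler_wpM2l a0 (precedence_sum sS u0 w0); rewrite mulrDr.
have := ler_wpM2r pwu (dpos _ _ uw); rewrite -/(a u) -/(a w).
set X := a u * (_ * _); lra.
Qed.

End optimality.

(** * Optimal searches *)

Section conclusion.
Context {R : realType} {Q : tree_network R}.
Implicit Types (u v w z : node Q) (x y : location Q).

Variable h : probability (borel Q) R.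
Hypothesis hmono : monotone_distribution h.
Local Notation mass := (mass h).
Local Notation H v := (mass (in_branch v)).

Section search.
Variable S : R -> location Q.
Hypothesis speedS : unit_speed S.

Lemma measurable_lower_time : measurable_fun setT (lower_time h S : borel Q -> R).
Proof.
apply: measurable_funD; first exact: measurable_depth.
under eq_fun do rewrite big_mkcond/=.
apply: measurable_sum => w; case: (eqVneq w root) => [_|w0]/=; first exact: measurable_cst.
under eq_fun do rewrite big_mkcond/=.
apply: measurable_sum => u; case: (boolP (sibling w u)) => [/and3P[u0 _ _]|_]; last exact: measurable_cst.
by apply: measurable_funM; [exact: measurable_cst|exact: measurable_precedence].
Qed.

Lemma lower_time_ge0 x : 0 <= lower_time h S x.
Proof.
apply: addr_ge0; first exact: depth_ge0.
apply: sumr_ge0 => w w0; apply: sumr_ge0 => u /and3P[u0 _ _].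
apply: mulr_ge0; last by rewrite mulr_ge0// mass_ge0.
by rewrite mulr_ge0// divr_ge0 ?branch_sum_len_ge0 ?mass_ge0.
Qed.

(** A lower bound with the same mean as the hitting time is almost surely equal to it, and the
    part of the branch of v beyond any interior point of the arc v has positive mass. *)
Lemma expected_time_tight v (s : R) :
  (expected_time S h <= \int[h]_x (lower_time h S x)%:E)%E -> v != root -> 0 <= s < len v ->
  exists2 x, s < covered x v & hitting_time S x = (lower_time h S x)%:E.
Proof.
move=> le v0 sv; pose f (x : borel Q) := (hitting_time S x - (lower_time h S x)%:E)%E.
have f0 x : (0 <= f x)%E by rewrite sube_ge0// lower_time_le.
have mf : measurable_fun setT f.
  apply: emeasurable_funB; first exact: measurable_hitting_time.
  by apply/measurable_EFinP; exact: measurable_lower_time.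
have low_fin : (\int[h]_x (lower_time h S x)%:E)%E \is a fin_num by rewrite integral_lower_time.
have If : (\int[h]_x f x = 0)%E.
  apply/eqP; rewrite eq_le integral_ge0// andbT.
  rewrite -(leeD2lE _ _ low_fin) adde0 -ge0_integralD//; last 2 first.
  - by move=> x _; rewrite lee_fin lower_time_ge0.
  - by apply/measurable_EFinP; exact: measurable_lower_time.
  apply: le_trans le; rewrite le_eqVlt; apply/orP; left; apply/eqP/eq_integral => x _.
  by rewrite addeC /f subeK.
have [N [mN N0 subN]] : ae_eq h setT f (cst 0%E).
  apply/ae_eq_integral_abs => //; rewrite -[RHS]If; apply: eq_integral => x _.
  by rewrite gee0_abs.
have mB : measurable ([set x | s < covered x v] : set (borel Q)) by exact: measurable_covered_gt.
apply: contrapT => none.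
have : (mass [set x | (s < covered x v)%R] <= mass N)%R.
  apply: mass_le => // x /= sx; apply: subN => /= fx; apply: none; exists x => //.
  have := fx I; rewrite /f /cst; case: (hitting_time S x) => [r| |]//= [] /eqP.
  by rewrite subr_eq0 => /eqP ->.
rewrite {2}/mass N0 /= leNgt => /negP; apply.
exact: mass_beyond_gt0.
Qed.

(** The times without waste form a bounded interval, closed by waste_growth. Its supremum is
    beyond hitting times of points arbitrarily close to the end of any arc. *)
Lemma tight_complete : (expected_time S h <= \int[h]_x (lower_time h S x)%:E)%E ->
  exists2 t, 0 <= t & waste S t = 0 /\ forall v, v != root -> explored S v t = len v.
Proof.
move=> le; pose Z := [set t | 0 <= t /\ waste S t = 0].
have Z0 : Z 0 by split; rewrite ?waste0.
have ubZ : has_ubound Z.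
  exists (2 * \sum_(v : node Q | v != root) len v) => t [t0]; rewrite /waste => wt.
  have : \sum_(v | v != root) explored S v t <= \sum_(v : node Q | v != root) len v.
    by apply: ler_sum => v v0; case/andP: (explored_itv speedS v0 t0).
  by have := depth_ge0 (S t); lra.
have supZ : has_sup Z by split; first by exists 0.
have supP t : Z t -> t <= sup Z by move=> Zt; exact: ub_le_sup.
exists (sup Z); first exact: supP.
split=> [|v v0].
  apply/eqP; rewrite eq_le waste_ge0// ?supP// andbT.
  apply/ler_addgt0Pl => e e0; rewrite addr0.
  have e20 : 0 < e / 2 by lra.
  have [t [t0 wt] te] := sup_adherent e20 supZ.
  have := @waste_growth _ _ _ speedS t (sup Z); rewrite t0 supP// wt => /(_ isT); lra.
have s0 : 0 <= sup Z by exact: supP.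
apply/eqP; rewrite eq_le; have /andP[_ -> /=] := explored_itv speedS v0 s0.
rewrite leNgt; apply/negP => lt_len.
have [|x sx /lower_time_tight[]//] := @expected_time_tight v (explored S v (sup Z)) le v0.
  by rewrite lt_len andbT; case/andP: (explored_itv speedS v0 s0).
move=> t t0 [wt Sx]; move: sx; rewrite -Sx ltNge => /negP; apply.
by apply: le_explored => //; rewrite t0 supP.
Qed.

End search.

Lemma tour_is_search D pos : unit_speed D -> (forall x, D (tour_time pos x) = x) -> search D.
Proof.
move=> sD pD; split; [exact: sD.1 | exact: sD.2 | apply: wasteless_normal => // t t0 ut].
by apply: (punctual_waste sD pD t0); exact: punctual_until_covered ut.
Qed.

End conclusion.

(** The depth-first search that visits denser branches first is a search, and its expected time
    is at most the mean of lower_time h S for every S. So an optimal S reaches this mean, which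
    makes it a depth-first search, in general with another order of the branches. *)
Theorem theorem4 (R : realType) (Q : tree_network R)
    (h : probability (borel Q) R) (hmono : monotone_distribution h) :
  strongly_simply_searchable h.
Proof.
move=> S [[S0 Slip Snorm] optS]; have sS : unit_speed S by split.
have [pos0 pos0_inj pos0_le] := sorting_position (fun v => L v / mass h (in_branch v)).
have [D0 [_ sD0 pD0]] := tour_search pos0_inj.
have tight : (expected_time S h <= \int[h]_x (lower_time h S x)%:E)%E.
  apply: le_trans (optS D0 (tour_is_search sD0 pD0)) _.
  apply: le_trans (_ : \int[h]_x (tour_time pos0 x)%:E <= _)%E.
    apply: ge0_le_integral => //.
    - by move=> x _; exact: hitting_time_ge0.
    - exact: measurable_hitting_time.
    - by apply/measurable_EFinP; exact: measurable_tour_time.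
    - move=> x _; apply/hitting_timeP => //; first exact: tour_time_ge0.
      by exists (tour_time pos0 x); rewrite ?pD0// tour_time_ge0 lexx.
  rewrite integral_tour_time integral_lower_time// lee_fin lerD2l.
  exact: tour_time_optimal.
have [t t0 [wt et]] := tight_complete hmono sS tight.
have [pos pos_inj pS] := wasteless_tour sS t0 wt et.
have [D [dfD sD pD]] := tour_search pos_inj.
by exists D => // s s0 us; exact: punctual_unique us.
Qed.
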